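(* Let $\mathbb{B}_n$ be the Poincaré ball model of the $n$-dimensional hyperbolic space, with $\rho(x)=\ln\frac{1+|x|}{1-|x|}$ the geodesic distance from $x$ to $0$. Suppose $n\ge3$, $k\in(1,n/2)$ is an integer, and $-2<\beta<n-2k$. Then there exists a constant $C>0$ such that the following hold for every $f\in C_0^\infty(\mathbb{B}_n)$. (i) If $k=2l$ with $l\ge1$, then $$\int_{\mathbb{B}_n}\frac{|\Delta_g^lf|^2}{\rho^\beta}\,dV_g\ge\frac1{c(n,2l,\beta,2)}\int_{\mathbb{B}_n}\frac{|f|^2}{\rho^{\beta+4l}}\,dV_g+\frac{6C(n-1)}{(n-4l-\beta)\,c(n,2l,\beta,2)}\int_{\mathbb{B}_n}\frac{|f|^2}{\rho^{4l+\beta-2}}\,dx .$$ (ii) If $k=2l+1$ with $l\ge1$, then $$\frac{4}{(n-2-\beta)^2}\,c(n,2l,2+\beta,2)\int_{\mathbb{B}_n}\frac{|\nabla_g\Delta_g^lf|_g^2}{\rho^\beta}\,dV_g\ge\int_{\mathbb{B}_n}\frac{|f|^2}{\rho^{\beta+2(2l+1)}}\,dV_g+\frac{6C(n-1)}{n-2(2l+1)-\beta}\int_{\mathbb{B}_n}\frac{|f|^2}{\rho^{\beta+4l}}\,dx .$$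
   Context: The constant is $$c(n,2l,\beta,p)=\left(\prod_{i=0}^{l-1}\frac{p^2}{(n-2p-\beta-2ip)(n(p-1)+\beta+2ip)}\right)^p,$$ used here with $p=2$. $\mathbb{B}_n=\{x\in\mathbb{R}^n:|x|<1\}$ is equipped with the hyperbolic metric $g=\left(\frac{2}{1-|x|^2}\right)^2\sum_i dx_i^2$ (constant sectional curvature $-1$). Its volume measure is $dV_g=\left(\frac{2}{1-|x|^2}\right)^ndx$, where $dx$ is Lebesgue measure. The Laplace--Beltrami operator is $\Delta_g=\frac{(1-|x|^2)^2}{4}\Delta+(n-2)\frac{1-|x|^2}{2}\,x\cdot\nabla$, $\Delta_g^l$ is its $l$-fold iterate, and $|\nabla_gu|_g=\frac{1-|x|^2}{2}|\nabla u|$ ($\nabla$ Euclidean) is the length of the Riemannian gradient. *)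

(* Defs.v *)
From HB Require Import structures.
From mathcomp Require Import all_boot all_order all_algebra.
From mathcomp Require Import all_classical all_reals all_analysis.

Set Implicit Arguments.
Unset Strict Implicit.
Unset Printing Implicit Defensive.

Import Order.TTheory GRing.Theory Num.Theory.
Import numFieldNormedType.Exports.

Local Open Scope classical_set_scope.
Local Open Scope ring_scope.

Section lebesgue_cons.
Context {R : realType} (n : nat).
Variable mu : {measure set (n.-tuple R) -> \bar R}.

Definition cons_pair (u : n.-tuple R * R) : n.+1.-tuple R :=
  [tuple of u.2 :: u.1].

Lemma measurable_cons_pair : measurable_fun setT cons_pair.
Proof. exact: measurable_cons. Qed.

(* The factors are paired as R^n * R because the right factor of \x has to be
   sigma-finite, which is canonical for lebesgue_measure. *)
Definition lebesgue_cons : set (n.+1.-tuple R) -> \bar R :=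
  pushforward (mu \x (@lebesgue_measure R))%E cons_pair.

HB.instance Definition _ := Measure.copy lebesgue_cons
  (measure_function_pushforward__canonical__measure_function_Measure
     (mu \x (@lebesgue_measure R))%E measurable_cons_pair).

End lebesgue_cons.

Fixpoint lebesgue_tuple (R : realType) (n : nat) :
    {measure set (n.-tuple R) -> \bar R} :=
  match n with
  | 0 => dirac [tuple]
  | m.+1 => lebesgue_cons (lebesgue_tuple R m)
  end.

Section poincare_ball.
Context {R : realType} {n : nat}.
Implicit Types (f u : 'rV[R]_n -> R) (x y : 'rV[R]_n).

(* The library norm `|x| on 'rV[R]_n is the sup norm. *)
Definition dotp x y : R := \sum_(i < n) x ord0 i * y ord0 i.
Definition enorm x : R := Num.sqrt (dotp x x).

Definition poincare_ball : set 'rV[R]_n := [set x | enorm x < 1].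

Definition rho x : R := ln ((1 + enorm x) / (1 - enorm x)).

Definition partial (i : 'I_n) u : 'rV[R]_n -> R :=
  fun x => 'D_(delta_mx ord0 i) u x.

Definition iter_partial (s : seq 'I_n) u : 'rV[R]_n -> R := foldr partial u s.

Definition smooth u : Prop := forall s : seq 'I_n,
  continuous (iter_partial s u) /\
  forall (i : 'I_n) x, derivable (iter_partial s u) x (delta_mx ord0 i).

(* Elements of C_0^oo(B_n) are identified with their extensions by zero. *)
Definition test_function f : Prop :=
  [/\ smooth f,
      compact (closure [set x | f x != 0]) &
      closure [set x | f x != 0] `<=` poincare_ball].

Definition grad u x : 'rV[R]_n := \row_i partial i u x.

Definition laplacian u x : R := \sum_(i < n) partial i (partial i u) x.

Definition laplace_beltrami u : 'rV[R]_n -> R := fun x =>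
  (1 - enorm x ^+ 2) ^+ 2 / 4 * laplacian u x
  + (n%:R - 2) * ((1 - enorm x ^+ 2) / 2) * dotp x (grad u x).

Definition hyp_grad_norm u x : R := (1 - enorm x ^+ 2) / 2 * enorm (grad u x).

(* The integrands used below are nonnegative, so these integrals are always
   meaningful elements of [0, +oo]. *)
Definition integral_dx (F : 'rV[R]_n -> R) : \bar R :=
  (\int[lebesgue_tuple R n]_(t in
      [set t | poincare_ball (\row_i tnth t i)]) (F (\row_i tnth t i))%:E)%E.

Definition integral_dV (F : 'rV[R]_n -> R) : \bar R :=
  integral_dx (fun x => F x * (2 / (1 - enorm x ^+ 2)) ^+ n).

End poincare_ball.

(* rellich_const n l beta p is c(n, 2l, beta, p). *)
Definition rellich_const {R : realType} (n l : nat) (beta : R) (p : nat) : R :=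
  (\prod_(i < l)
     (p%:R ^+ 2 /
      ((n%:R - 2 * p%:R - beta - 2 * i%:R * p%:R) *
       (n%:R * (p%:R - 1) + beta + 2 * i%:R * p%:R)))) ^+ p.

(* Main.v *)
(** Work with the regularised weights u = rho^2 + d, d > 0, which are C^1 across
    the origin as functions of s = |x|^2.  Expanding the squares
    (u Delta_g f + K f)^2 and |grad f + lambda f x|^2 shows that, up to the
    divergence of an explicit compactly supported C^1 vector field,
    |Delta_g f|^2 u^(-beta/2) dominates K^2 f^2 u^(-beta/2-2) plus a multiple of
    (rho coth rho - 1) f^2 u^(-beta/2-2), without any error term in d.  These
    inequalities have matching weights, so they iterate, with one Hardy step for
    odd k; only at the end does d tend to 0, by monotone convergence.  The
    remainder with respect to Lebesgue measure comes from
    (rho coth rho - 1) dV_g >= 2 rho^2 dx. *)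

Require Import Defs.
From HB Require Import structures.
From mathcomp Require Import all_boot all_order all_algebra.
From mathcomp Require Import all_classical all_reals all_analysis.
From mathcomp Require Import measurable_realfun.
From mathcomp Require Import ring lra.

Set Implicit Arguments.
Unset Strict Implicit.
Unset Printing Implicit Defensive.

Import Order.TTheory GRing.Theory Num.Theory.
Import numFieldNormedType.Exports.

Local Open Scope classical_set_scope.
Local Open Scope ring_scope.

(** A test function need not vanish at the origin, where [rho] is not differentiable and the weights
    on [f] blow up, so no divergence theorem applies to the singular weights. With [m = rho / |x|],
    only the combinations [s m^2 = rho^2] and [x_i m] get differentiated at the origin, and mere
    continuity of [m] is enough for both. The constants come from the power [r^(-a)],
    [a = (n-4-b)/2]: for the Euclidean Laplacian, [r^2 Delta r^(-a) = -K r^(-a)] with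
    [K = (n-4-b)(n+b)/4]. For [d = 0] both squares of a Rellich step vanish on [rho^(-a)] to leading
    order at the origin. The terms carrying [d] have a favourable sign because
    [4K = (n-2)^2 - (b+2)^2 < 2n(n-2)]. Only the innermost Rellich step keeps its remainder, whence
    the denominator [n - 4l - beta]; its coefficient has numerator [2(n-1)], and the volume
    comparison doubles it, so [6C = 4]. Monotone convergence serves the side of [f]. On the other
    side, for [-2 < beta < 0], the weight is a power of [u] with exponent below 1, and regularising
    adds at most [d^(-beta/2)] to it. *)

Section lebesgue_tuple_theory.
Context {R : realType}.
Notation leb := (@lebesgue_measure R).

(** * Lebesgue measure on tuples: finiteness on boxes and sigma-finiteness *)

Definition tuple_box n (M : R) : set (n.-tuple R) :=
  [set t | forall i, `|tnth t i| <= M].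

Lemma measurable_tuple_box n (M : R) : measurable (@tuple_box n M).
Proof.
have -> : @tuple_box n M =
    \bigcap_(i in [set: 'I_n]) ((@tnth _ R ^~ i) @^-1` [set y | `|y| <= M]).
  apply/seteqP; split=> t /= h; first by move=> i _; exact: h.
  by move=> i; exact: h.
apply: fin_bigcap_measurable => // i _.
rewrite -[X in measurable X]setTI; apply: measurable_tnth => //.
have -> : [set y : R | `|y| <= M] = `[- M, M]%classic.
  by apply/seteqP; split=> y /=; rewrite in_itv/= ler_norml.
exact: measurable_itv.
Qed.

Lemma cons_pair_box n (M : R) :
  @cons_pair R n @^-1` @tuple_box n.+1 M
  = @tuple_box n M `*` `[- M, M]%classic.
Proof.
apply/seteqP; split=> -[u y] /=.
- move=> h; split.
  + by move=> i; have := h (lift ord0 i); rewrite tnthS.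
  + by have := h ord0; rewrite in_itv/= -ler_norml.
- move=> [h1 h2] i; case: (unliftP ord0 i) => [j|] ->.
  + by rewrite tnthS.
  + by move: h2; rewrite in_itv/= -ler_norml.
Qed.

Lemma lebesgue_tuple_box n (M : R) :
  (lebesgue_tuple R n (@tuple_box n M) < +oo)%E.
Proof.
elim: n => [|n IH].
  have -> : @tuple_box 0 M = setT by apply/seteqP; split=> // t _ [].
  by rewrite /= diracT ltry.
have -> : lebesgue_tuple R n.+1 (@tuple_box n.+1 M) =
  ((lebesgue_tuple R n \x leb) (@cons_pair R n @^-1` @tuple_box n.+1 M))%E by [].
rewrite cons_pair_box product_measure1E//; last exact: measurable_tuple_box.
rewrite lte_mul_pinfty//.
  by rewrite ge0_fin_numE.
by have /= -> := @lebesgue_measure_itv R `[- M, M]; case: ifP => _ //; rewrite -EFinB ltry.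
Qed.

(* Typed as a bare function so that a sigma-finite instance can be attached. *)
Definition ltup n : set (n.-tuple R) -> \bar R := lebesgue_tuple R n.

HB.instance Definition _ n := Measure.copy (@ltup n) (lebesgue_tuple R n).

(** Lets Fubini exchange the tuple factor with the real factor, so that either one can be integrated
    innermost. *)
Lemma ltup_sigma_finite n : sigma_finite setT (@ltup n).
Proof.
exists (fun k => @tuple_box n k%:R).
  apply/esym/seteqP; split => // t _.
  exists (Num.truncn (\sum_i `|tnth t i|)).+1 => //= i.
  apply: (@le_trans _ _ (\sum_i `|tnth t i|)).
    by rewrite (bigD1 i)//= lerDl sumr_ge0.
  by apply/ltW/truncnS_gt.
move=> k; split; first exact: measurable_tuple_box.
exact: lebesgue_tuple_box.
Qed.

HB.instance Definition _ n := Measure_isSigmaFinite.Build _ _ _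
  (@ltup n) (@ltup_sigma_finite n).

Lemma measurable_cons_pairR n : measurable_fun
  [set: n.-tuple R * measurableTypeR R] (@cons_pair R n).
Proof. exact: measurable_cons_pair. Qed.

Lemma ltupS_integral n (f : n.+1.-tuple R -> \bar R) :
  measurable_fun [set: n.+1.-tuple R] f ->
  (@ltup n \x leb)%E.-integrable setT (f \o @cons_pair R n) ->
  (\int[lebesgue_tuple R n.+1]_t f t =
   \int[@ltup n \x leb]_p f (cons_pair p))%E.
Proof.
move=> mf intf.
exact: (@integral_pushforward _ _ _ _ R _ (measurable_cons_pairR (n:=n)) _ _ _ mf intf measurableT).
Qed.

End lebesgue_tuple_theory.

(** * Vanishing of integrals of derivatives, in one variable and then on tuples *)

Section calculus_tools.
Context {R : realType}.

(** Brings directional derivatives down to ordinary ones, so that the chain rule and the fundamental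
    theorem of calculus in one variable apply to them. *)
Lemma is_derive_line (V W : normedModType R) (f : V -> W) x v df :
  is_derive x v f df <-> is_derive (0 : R) 1 (fun h => f (h *: v + x)) df.
Proof.
have E : 'D_v f x = 'D_1 (fun h : R => f (h *: v + x)) 0.
  rewrite /derive; set g1 := fun h => h^-1 *: _; set g2 := fun h => h^-1 *: _.
  suff -> : g1 = g2 by [].
  by rewrite funeqE /g1 /g2 => h /=; rewrite addr0 scale0r add0r [_%:A]mulr1.
split=> -[d <-]; split; rewrite ?E //.
  by move/derivable1P: d.
by apply/derivable1P.
Qed.

Lemma integral_derivative_eq0 (G g : R -> R) (M : R) : 0 <= M ->
  (forall z : R, is_derive z 1 G (g z)) -> continuous g ->
  (forall z, M < `|z| -> G z = 0 /\ g z = 0) ->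
  (\int[@lebesgue_measure R]_z (g z)%:E = 0)%E.
Proof.
move=> M0 dG cg supp.
(* The support hypothesis is strict in [M], so the endpoints are moved past [M]; there [G]
   vanishes. *)
pose a := M + 1.
have a0 : - a < a by rewrite /a; lra.
have -> : (\int[@lebesgue_measure R]_z (g z)%:E =
           \int[@lebesgue_measure R]_(z in `[(- a)%R, a]) (g z)%:E)%E.
  rewrite [RHS]integral_mkcond; apply: eq_integral => z _.
  rewrite patchE; case: ifPn => // /negP zn.
  have [|_ ->//] := supp z.
  rewrite ltNge; apply/negP => h; apply: zn; rewrite inE /= in_itv /= -ler_norml.
  by rewrite /a; lra.
rewrite (@continuous_FTC2 R g G)//.
- have [|-> _] := supp a; first by rewrite ger0_norm /a; lra.
  have [|-> _] := supp (- a); first by rewrite normrN ger0_norm /a; lra.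
  by rewrite subee.
- exact: continuous_subspaceT.
- have cG : continuous G.
    move=> z; apply: differentiable_continuous; apply/derivable1_diffP.
    by have [] := dG z.
  split.
  + by move=> z _; have [] := dG z.
  + exact: cvg_at_right_filter (cG _).
  + exact: cvg_at_left_filter (cG _).
- by move=> z _; rewrite derive1E; have [_] := dG z.
Qed.

End calculus_tools.

Lemma integrable_bounded_support d (T : measurableType d) (R : realType)
    (mu : {measure set T -> \bar R}) (A : set T) (f : T -> R) (B : R) :
  measurable A -> (mu A < +oo)%E -> measurable_fun setT f ->
  (forall t, `|f t| <= B) -> (forall t, ~ A t -> f t = 0) ->
  mu.-integrable setT (EFin \o f).
Proof.
move=> mA Afin mf fB f0.
have -> : EFin \o f = (EFin \o f) \_ A.
  apply/funext => t; rewrite patchE; case: ifPn => // /negP h /=.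
  by rewrite f0// => At; apply: h; rewrite inE.
apply/(integrable_mkcond _ mA).1.
apply: measurable_bounded_integrable => //.
  exact: measurable_funS mf.
exists B; split; first exact: num_real.
by move=> x Bx t _; apply: le_trans (fB t) _; exact: ltW.
Qed.

Section tuple_divergence.
Context {R : realType}.

(** The tuple counterpart of moving a row vector by [y] along the i-th basis vector; on tuples it
    commutes with consing, which the induction on the dimension needs. *)
Definition tuple_shift n (i : 'I_n) (t : n.-tuple R) (y : R) : n.-tuple R :=
  [tuple tnth t j + y *+ (j == i) | j < n].

Lemma tuple_shift0 n u (z y : R) :
  tuple_shift ord0 (@cons_pair R n (u, z)) y = cons_pair (u, y + z).
Proof.
apply: eq_from_tnth => j; rewrite tnth_mktuple.
case: (unliftP ord0 j) => [k|] ->.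
  by rewrite !tnthS /= addr0.
by rewrite eqxx mulr1n /= addrC.
Qed.

Lemma tuple_shiftS n j u (z y : R) :
  tuple_shift (lift ord0 j) (@cons_pair R n (u, z)) y
  = cons_pair (tuple_shift j u y, z).
Proof.
apply: eq_from_tnth => k; rewrite tnth_mktuple.
case: (unliftP ord0 k) => [l|] ->.
  by rewrite !tnthS /= tnth_mktuple (inj_eq lift_inj).
by rewrite (negbTE (neq_lift _ _)) mulr0n addr0.
Qed.

Lemma cons_pair_boxP n (M : R) (u : n.-tuple R) y :
  tuple_box M (cons_pair (u, y)) <-> tuple_box M u /\ `|y| <= M.
Proof.
split.
- move=> h; split; last by have := h ord0.
  by move=> i; have := h (lift ord0 i); rewrite tnthS.
- move=> [h1 h2] i; case: (unliftP ord0 i) => [j|] -> //.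
  by rewrite tnthS.
Qed.

(** Fubini with induction on [n]. If the differentiated coordinate is the first one, the inner
    integral runs over it and vanishes by the one-variable case; otherwise the first coordinate is
    frozen and the inner integral vanishes by induction. The bound and the box provide the
    integrability. *)
Lemma tuple_integral_derivative_eq0 n (i : 'I_n) (G g : n.-tuple R -> R)
    (M B : R) : 0 <= M ->
  measurable_fun [set: n.-tuple R] g -> (forall t, `|g t| <= B) ->
  (forall t, ~ tuple_box M t -> G t = 0 /\ g t = 0) ->
  (forall t, is_derive (0 : R) 1 (fun y => G (tuple_shift i t y)) (g t)) ->
  (forall t, continuous (fun y => g (tuple_shift i t y))) ->
  (\int[lebesgue_tuple R n]_t (g t)%:E = 0)%E.
Proof.
move=> M0; elim: n => [|n IH] in i G g *; first by case: i.
move=> mg gB supp dG cg.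
have mgc : measurable_fun [set: n.-tuple R * measurableTypeR R]
    (g \o @cons_pair R n).
  by apply: measurableT_comp => //; exact: measurable_cons_pairR.
have intg : (@ltup R n \x (@lebesgue_measure R))%E.-integrable setT
    ((EFin \o g) \o @cons_pair R n).
  have -> : (EFin \o g) \o @cons_pair R n = EFin \o (g \o @cons_pair R n) by [].
  apply: (@integrable_bounded_support _ _ R (@ltup R n \x (@lebesgue_measure R))%E
    (@cons_pair R n @^-1` @tuple_box R n.+1 M) (g \o @cons_pair R n) B) => //.
  - rewrite -[X in measurable X]setTI; apply: measurable_cons_pairR => //.
    exact: measurable_tuple_box.
  - exact: (lebesgue_tuple_box n.+1 M).
  - by move=> t; exact: gB.
  - by move=> t Ht /=; have [] := supp _ Ht.
rewrite (ltupS_integral (f := EFin \o g))//; last exact/measurable_EFinP.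
case: (unliftP ord0 i) => [j|] iE; subst i.
- rewrite -(integral21_prod_meas1 intg).
  apply: integral0_eq => y _.
  apply: (IH j (fun u => G (cons_pair (u, y))) (fun u => g (cons_pair (u, y)))).
  + apply: (measurableT_comp mgc); exact: measurable_pair2.
  + by move=> t; exact: gB.
  + by move=> t Ht; apply: supp => /cons_pair_boxP[].
  + move=> t; have := dG (cons_pair (t, y)).
    by under eq_fun do rewrite tuple_shiftS.
  + move=> t; have := cg (cons_pair (t, y)).
    by under eq_fun do rewrite tuple_shiftS.
- rewrite -(integral12_prod_meas1 intg).
  apply: integral0_eq => u _.
  apply: (@integral_derivative_eq0 _ (fun y => G (cons_pair (u, y)))
     (fun y => g (cons_pair (u, y))) M) => //.
  + move=> z; apply/is_derive_line; have := dG (cons_pair (u, z)).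
    under eq_fun do rewrite tuple_shift0.
    by under [X in _ -> is_derive _ _ X _]eq_fun do rewrite [_%:A]mulr1.
  + have := cg (cons_pair (u, 0)).
    under eq_fun do rewrite tuple_shift0.
    by under eq_fun do rewrite addr0.
  + move=> z Mz; apply: supp => /cons_pair_boxP[_].
    by rewrite leNgt Mz.
Qed.

End tuple_divergence.

(** * Measurability on tuples of continuous functions of row vectors *)

Section tuple_row.
Context {R : realType}.

Definition tuple_row n (t : n.-tuple R) : 'rV[R]_n := \row_i tnth t i.

(** Tuples carry the product sigma-algebra, row vectors the sup-norm topology. An open set is the
    countable union of the balls with rational centre and radius [1/(k+1)] that it contains, and a
    sup-norm ball is a finite intersection of coordinate conditions. *)
Lemma measurable_tuple_row_open n (O : set 'rV[R]_n) : open O ->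
  measurable (@tuple_row n @^-1` O).
Proof.
move=> oO.
pose F (p : 'rV[rat]_n * nat) : set (n.-tuple R) :=
  let c : 'rV[R]_n := map_mx ratr p.1 in
  if `[< ball c p.2.+1%:R^-1 `<=` O >]
  then @tuple_row n @^-1` (ball c p.2.+1%:R^-1) else set0.
have -> : @tuple_row n @^-1` O = \bigcup_p F p.
  apply/seteqP; split=> t /=.
  - move=> Ot; have /nbhs_ballP[e /= e0 eO] : nbhs (tuple_row t) O.
      by apply: open_nbhs_nbhs; split.
    (* Half of [e], because the ball is centred at a rational point that is itself within [1/(k+1)]
       of [t]. *)
    have [k ke] : exists k : nat, k.+1%:R^-1 < e / 2.
      exists (Num.truncn (2 / e)).
      rewrite invf_plt ?posrE ?divr_gt0// invf_div.
      exact: truncnS_gt.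
    have q_ i : {q : rat | `|tnth t i - ratr q| < k.+1%:R^-1}.
      apply: cid.
      have lt : tnth t i - k.+1%:R^-1 < tnth t i + k.+1%:R^-1.
        by rewrite ltrD2l -subr_gt0 opprK addr_gt0.
      have [q] := rat_in_itvoo lt; rewrite in_itv /= => /andP[q1 q2].
      by exists q; rewrite ltr_norml; apply/andP; split;
         [rewrite ltrNl opprB ltrBlDl|rewrite ltrBlDr addrC -ltrBlDr].
    exists (\row_i sval (q_ i), k) => //=.
    rewrite /F /=; case: ifPn => [_|/asboolP].
      rewrite /=; split; first by [].
      move=> i j; rewrite !mxE /ball /= distrC; exact: (svalP (q_ j)).
    case=> z [_ hz]; apply: eO; split => // i j.
    have := hz i j; rewrite !mxE /ball /= => h1.
    have h2 := svalP (q_ j); rewrite (ord1 i) in h1 *.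
    have -> : tnth t j - z ord0 j = (tnth t j - ratr (sval (q_ j))) + (ratr (sval (q_ j)) - z ord0 j) by ring.
    apply: le_lt_trans (ler_normD _ _) _.
    apply: (@lt_trans _ _ (k.+1%:R^-1 + k.+1%:R^-1)).
      exact: ltrD.
    by rewrite (splitr e) ltrD.
  - move=> [p _]; rewrite /F; case: ifPn => // /asboolP pO; exact: pO.
apply: countable_bigcupT_measurable => [|p]; first exact: countableP.
rewrite /F; case: ifPn => // _.
have -> : @tuple_row n @^-1` ball (map_mx ratr p.1 : 'rV[R]_n) p.2.+1%:R^-1 =
   \bigcap_(i in [set: 'I_n]) ((@tnth _ R ^~ i) @^-1` (ball (ratr (p.1 ord0 i) : R) p.2.+1%:R^-1)).
  apply/seteqP; split=> t /=.
  - by move=> [_ h] i _; have := h ord0 i; rewrite !mxE.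
  - by move=> h; split => // i j; have := h j I; rewrite !mxE (ord1 i).
apply: fin_bigcap_measurable => // i _.
rewrite -[X in measurable X]setTI; apply: measurable_tnth => //.
exact: measurable_ball.
Qed.

Lemma measurable_tuple_row_continuous n (F : 'rV[R]_n -> R) : continuous F ->
  measurable_fun [set: n.-tuple R] (F \o @tuple_row n).
Proof.
move=> cF; apply: (measurability _ (RGenOInfty.measurableE R)).
move=> /= _ [_ [a ->] <-]; rewrite setTI.
rewrite (_ : _ @^-1` _ = @tuple_row n @^-1` (F @^-1` `]a, +oo[%classic))//.
apply: measurable_tuple_row_open.
by apply: open_comp => //.
Qed.

End tuple_row.

Lemma continuous_at_sum (R : realType) (T : topologicalType) n
    (F : 'I_n -> T -> R) (x : T) :
  (forall i, {for x, continuous (F i)}) ->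
  {for x, continuous (fun y => \sum_i F i y)}.
Proof.
move=> cF; have -> : (fun y => \sum_i F i y) = \sum_i F i.
  by apply/funext => y; rewrite fct_sumE.
apply: (big_ind (fun f : T -> R => {for x, continuous f})) => //.
- exact: cvg_cst.
- by move=> f g; exact: continuousD.
Qed.

(** * Integrals over the ball and the divergence theorem *)

Section ball_integrals.
Context {R : realType} {n : nat}.
Implicit Types (F G : 'rV[R]_n -> R) (x : 'rV[R]_n).

Definition sqn x : R := dotp x x.

Lemma sqn_ge0 x : 0 <= sqn x.
Proof. by apply: sumr_ge0 => i _; rewrite -expr2 sqr_ge0. Qed.

Lemma sqr_enorm x : enorm x ^+ 2 = sqn x.
Proof. by rewrite sqr_sqrtr// sqn_ge0. Qed.

Lemma enorm_ge0 x : 0 <= enorm x.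
Proof. exact: sqrtr_ge0. Qed.

Lemma poincare_ballE x : poincare_ball x <-> sqn x < 1.
Proof. by rewrite /poincare_ball /= /enorm -{1}(@sqrtr1 R) ltr_sqrt. Qed.

Lemma sqr_coord_le_sqn x i : x ord0 i ^+ 2 <= sqn x.
Proof.
rewrite /sqn /dotp (bigD1 i)//= -expr2 lerDl sumr_ge0// => j _.
by rewrite -expr2 sqr_ge0.
Qed.

Lemma sqn_continuous : continuous (@sqn).
Proof.
move=> x; apply: continuous_at_sum => i.
by apply: continuousM; exact: coord_continuous.
Qed.

(** Stands in for compact support in the ball: it passes to sums, products and derivatives at once,
    and it also forces [F] to vanish outside the ball, where the radial weights carry no meaning. *)
Definition inner_support F :=
  exists2 s0 : R, s0 < 1 & forall x, s0 < sqn x -> F x = 0.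

Lemma inner_support_outside F x : inner_support F -> 1 <= sqn x -> F x = 0.
Proof. by move=> [s s1 F0] h; apply: F0; exact: lt_le_trans h. Qed.

Definition ball_tuple : set (n.-tuple R) :=
  [set t | poincare_ball (\row_i tnth t i)].

Lemma measurable_ball_tuple : measurable ball_tuple.
Proof.
have -> : ball_tuple = @tuple_row R n @^-1` (@sqn @^-1` `]-oo, 1[%classic).
  by apply/seteqP; split=> t /=; rewrite in_itv /= => /poincare_ballE.
apply: measurable_tuple_row_open.
by apply: open_comp => //; move=> x _; exact: sqn_continuous.
Qed.

Lemma inner_support_box F t : inner_support F -> ~ tuple_box 1 t ->
  F (tuple_row t) = 0.
Proof.
move=> sF bt; apply: inner_support_outside => //.
rewrite leNgt; apply/negP => h; apply: bt => i.
have := sqr_coord_le_sqn (tuple_row t) i; rewrite mxE => h2.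
by rewrite -(@expr_le1 _ 2)// real_normK ?num_real//; lra.
Qed.

Lemma inner_support_bounded F : continuous F -> inner_support F ->
  exists B : R, forall x, `|F x| <= B.
Proof.
move=> cF sF.
pose A := [set v : 'rV[R]_n | forall i, v ord0 i \in `[(- 1), 1]].
have cA : compact A.
  apply: (@rV_compact _  _ (fun=> `[(- 1 : R), 1]%classic)).
  by move=> _; apply: segment_compact.
have A0 : A !=set0.
  by exists 0 => i; rewrite mxE in_itv /=; lra.
have cN : {within A, continuous (fun x => `|F x|)}.
  apply: continuous_subspaceT => x.
  by apply: continuous_comp; [exact: cF|exact: norm_continuous].
have [c _ hc] := EVT_max_rV A0 cA cN.
exists (`|F c|) => x.
have [s1|s1] := ltP (sqn x) 1; last first.
  by rewrite (inner_support_outside sF s1) normr0.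
apply: hc; rewrite inE => i; rewrite in_itv /= -ler_norml.
have := sqr_coord_le_sqn x i => h2.
by rewrite -(@expr_le1 _ 2)// real_normK ?num_real//; lra.
Qed.

Lemma inner_support_integrable F D : continuous F -> inner_support F ->
  measurable D ->
  (lebesgue_tuple R n).-integrable D (EFin \o (F \o @tuple_row R n)).
Proof.
move=> cF sF mD; have [B FB] := inner_support_bounded cF sF.
apply: (@integrableS _ _ _ _ setT) => //.
apply: (@integrable_bounded_support _ _ _ _ (@tuple_box R n 1) _ B) => //.
- exact: measurable_tuple_box.
- exact: lebesgue_tuple_box.
- exact: measurable_tuple_row_continuous.
- by move=> t; exact: FB.
- by move=> t; exact: inner_support_box.
Qed.

Lemma integral_dx_partial_eq0 (i : 'I_n) (X D : 'rV[R]_n -> R) :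
  (forall x, is_derive x (delta_mx ord0 i : 'rV[R]_n) X (D x)) ->
  continuous D -> inner_support X -> inner_support D ->
  integral_dx D = 0%E.
Proof.
move=> dX cD sX sD; have [B DB] := inner_support_bounded cD sD.
have -> : integral_dx D = (\int[lebesgue_tuple R n]_t (D (tuple_row t))%:E)%E.
  rewrite /integral_dx integral_mkcond; apply: eq_integral => t _.
  rewrite patchE; case: ifPn => // /negP h.
  rewrite (inner_support_outside sD)// leNgt; apply/negP => h1; apply: h.
  by rewrite inE /=; apply/poincare_ballE.
have shiftE t y : tuple_row (tuple_shift i t y) =
    y *: (delta_mx ord0 i : 'rV[R]_n) + tuple_row t.
  apply/rowP => j; rewrite !mxE tnth_mktuple addrC eqxx /=.
  by case: (j == i) => /=; rewrite ?mulr1 ?mulr0.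
apply: (@tuple_integral_derivative_eq0 R n i (X \o @tuple_row R n)
   (D \o @tuple_row R n) 1 B) => //.
- exact: measurable_tuple_row_continuous.
- by move=> t; exact: DB.
- by move=> t bt /=; rewrite !inner_support_box.
- move=> t; have /is_derive_line := dX (tuple_row t).
  by rewrite /comp; under [X in _ -> is_derive _ _ X _]eq_fun do rewrite shiftE.
- move=> t y; rewrite /comp; under eq_fun do rewrite shiftE.
  apply: (@continuous_comp _ _ _ (fun y : R => y *: (delta_mx ord0 i : 'rV[R]_n) + tuple_row t) D); last exact: cD.
  by apply: cvgD; [apply: cvgZr_tmp; exact: cvg_id|exact: cvg_cst].
Qed.

(** Each [D i] is a partial derivative of an inner-supported function, hence has integral 0; adding
    them leaves the integral of [G] unchanged and reduces the claim to a pointwise comparison. *)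
Lemma le_integral_dx_divergence F G (X D : 'I_n -> 'rV[R]_n -> R) :
  continuous F -> inner_support F -> continuous G -> inner_support G ->
  (forall i x, is_derive x (delta_mx ord0 i : 'rV[R]_n) (X i) (D i x)) ->
  (forall i, continuous (D i)) ->
  (forall i, inner_support (X i)) -> (forall i, inner_support (D i)) ->
  (forall x, sqn x < 1 -> G x + \sum_i D i x <= F x) ->
  (integral_dx G <= integral_dx F)%E.
Proof.
move=> cF sF cG sG dX cD sX sD h.
have mB := measurable_ball_tuple.
have iF := inner_support_integrable cF sF mB.
have iG := inner_support_integrable cG sG mB.
have iD i := inner_support_integrable (cD i) (sD i) mB.
have iS : (lebesgue_tuple R n).-integrable ball_tuple
    (fun t => \sum_i (EFin \o (D i \o @tuple_row R n)) t)%E.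
  by apply: integrable_sum.
have -> : integral_dx G = (\int[lebesgue_tuple R n]_(t in ball_tuple)
   ((G (tuple_row t))%:E + \sum_i (EFin \o (D i \o @tuple_row R n)) t))%E.
  rewrite integralD// integral_sum// big1 ?adde0// => i _.
  exact: (integral_dx_partial_eq0 (dX i)).
apply: le_integral => //; first exact: integrableD.
move=> t; rewrite inE => /poincare_ballE /h.
by rewrite sumEFin -EFinD lee_fin.
Qed.

End ball_integrals.

(** * Derivation rules, smooth functions and inner supports *)

Section derivation_rules.
Context {R : realType} {V : normedModType R}.
Implicit Types (f g : V -> R) (x v : V).

Lemma is_derive_addf f g x v df dg : is_derive x v f df ->
  is_derive x v g dg -> is_derive x v (fun y => f y + g y) (df + dg).
Proof. by move=> hf hg; exact: is_deriveD. Qed.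

Lemma is_derive_oppf f x v df : is_derive x v f df ->
  is_derive x v (fun y => - f y) (- df).
Proof. by move=> hf; exact: is_deriveN. Qed.

Lemma is_derive_mulf f g x v df dg : is_derive x v f df ->
  is_derive x v g dg -> is_derive x v (fun y => f y * g y) (df * g x + f x * dg).
Proof.
move=> hf hg; have := @is_deriveM _ _ f g x v df dg hf hg.
by rewrite addrC /GRing.scale /= (mulrC (g x)).
Qed.

Lemma is_derive_cstf (c : R) x v : is_derive x v (fun _ => c) 0.
Proof. exact: is_derive_cst. Qed.

Lemma is_derive_comp1 (P : R -> R) f x v dP df :
  is_derive (f x) (1 : R) P dP -> is_derive x v f df ->
  is_derive x v (fun y => P (f y)) (dP * df).
Proof.
move=> hP /is_derive_line hf; apply/is_derive_line.
apply: (@is_derive1_comp R P (fun h => f (h *: v + x)) 0 dP df) => //.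
by rewrite scale0r add0r.
Qed.

Lemma is_derive_near0 f x v : (\forall y \near x, f y = 0) -> is_derive x v f 0.
Proof.
move=> h; apply: (@near_eq_is_derive _ _ _ (fun _ => 0) f).
  by move: h; apply: filterS => y ->.
Qed.

Lemma is_derive_uniq f x v d1 d2 :
  is_derive x v f d1 -> is_derive x v f d2 -> d1 = d2.
Proof. by move=> [_ <-] [_ <-]. Qed.

End derivation_rules.

Section smooth_functions.
Context {R : realType} {n : nat}.
Implicit Types (f u : 'rV[R]_n -> R) (x : 'rV[R]_n).

Lemma is_derive_coord j x (v : 'rV[R]_n) :
  is_derive x v (fun y : 'rV[R]_n => y ord0 j) (v ord0 j).
Proof.
apply/is_derive_line.
have -> : (fun h : R => (h *: v + x) ord0 j) = (fun h => h * v ord0 j + x ord0 j).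
  by apply/funext => h; rewrite !mxE.
have h0 : is_derive (0 : R) (1 : R) (fun h : R => h) 1 by exact: is_derive_id.
have := is_derive_addf (is_derive_mulf h0 (is_derive_cstf (v ord0 j) (0 : R) 1))
  (is_derive_cstf (x ord0 j) (0 : R) 1).
by rewrite mul1r mulr0 !addr0.
Qed.

(** [smooth] speaks of all iterated partials, for which no closed product formula is at hand. This
    class is closed under products by construction and under [partial] by the Leibniz rule, so its
    members are smooth by induction on the list of indices. *)
Inductive smooth_alg : ('rV[R]_n -> R) -> Prop :=
| sa_smooth u : smooth u -> smooth_alg u
| sa_cst c : smooth_alg (fun=> c)
| sa_coord j : smooth_alg (fun x => x ord0 j)
| sa_add u1 u2 : smooth_alg u1 -> smooth_alg u2 ->
    smooth_alg (fun x => u1 x + u2 x)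
| sa_mul u1 u2 : smooth_alg u1 -> smooth_alg u2 ->
    smooth_alg (fun x => u1 x * u2 x).

Lemma smooth_continuous u : smooth u -> continuous u.
Proof. by move=> h; case: (h [::]). Qed.

Lemma smooth_partial i u : smooth u -> smooth (partial i u).
Proof.
by move=> h s; have := h (rcons s i); rewrite /iter_partial foldr_rcons.
Qed.

Lemma smooth_is_derive i u x : smooth u ->
  is_derive x (delta_mx ord0 i : 'rV[R]_n) u (partial i u x).
Proof. by move=> h; apply: derivableP; case: (h [::]). Qed.

Lemma smooth_alg_partial u : smooth_alg u -> continuous u /\
  forall i, (forall x, derivable u x (delta_mx ord0 i)) /\
    smooth_alg (partial i u).
Proof.
elim => {u} [u su|c|j|u1 u2 s1 [c1 h1] s2 [c2 h2]|u1 u2 s1 [c1 h1] s2 [c2 h2]].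
- split=> [|i]; first exact: smooth_continuous.
  split=> [x|]; last exact/sa_smooth/smooth_partial.
  by have [] := smooth_is_derive i x su.
- split=> [|i]; first by move=> x; apply: cst_continuous.
  split=> [x|]; first exact: derivable_cst.
  rewrite (_ : partial i _ = fun=> 0); first exact: sa_cst.
  by apply/funext => x; rewrite /partial derive_cst.
- split=> [|i]; first by move=> x; exact: coord_continuous.
  split=> [x|]; first by have [] := is_derive_coord j x (delta_mx ord0 i).
  rewrite (_ : partial i _ = fun=> (delta_mx ord0 i : 'rV[R]_n) ord0 j).
    exact: sa_cst.
  by apply/funext => x; have [] := is_derive_coord j x (delta_mx ord0 i).
- split=> [|i]; first by move=> x; apply: continuousD; [exact: c1|exact: c2].
  have D x : is_derive x (delta_mx ord0 i : 'rV[R]_n) (fun x => u1 x + u2 x)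
      (partial i u1 x + partial i u2 x).
    by apply: is_derive_addf; apply: derivableP;
      [case: (h1 i)|case: (h2 i)].
  split=> [x|]; first by have [] := D x.
  rewrite (_ : partial i _ = fun x => partial i u1 x + partial i u2 x).
    by apply: sa_add; [case: (h1 i)|case: (h2 i)].
  by apply/funext => x; have [] := D x.
- split=> [|i]; first by move=> x; apply: continuousM; [exact: c1|exact: c2].
  have D x : is_derive x (delta_mx ord0 i : 'rV[R]_n) (fun x => u1 x * u2 x)
      (partial i u1 x * u2 x + u1 x * partial i u2 x).
    by apply: is_derive_mulf; apply: derivableP;
      [case: (h1 i)|case: (h2 i)].
  split=> [x|]; first by have [] := D x.
  rewrite (_ : partial i _ =
      fun x => partial i u1 x * u2 x + u1 x * partial i u2 x).
    apply: sa_add; apply: sa_mul => //; [by case: (h1 i)|by case: (h2 i)].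
  by apply/funext => x; have [] := D x.
Qed.

Lemma smooth_alg_smooth u : smooth_alg u -> smooth u.
Proof.
move=> su s.
suff /smooth_alg_partial[c h] : smooth_alg (iter_partial s u).
  by split => // i x; case: (h i).
elim: s => //= i s /smooth_alg_partial[_ h].
by case: (h i).
Qed.

Lemma smooth_alg_sum (F : 'I_n -> 'rV[R]_n -> R) :
  (forall i, smooth_alg (F i)) -> smooth_alg (fun x => \sum_i F i x).
Proof.
move=> h; have -> : (fun y => \sum_i F i y) = \sum_i F i.
  by apply/funext => y; rewrite fct_sumE.
apply: (big_ind smooth_alg) => //.
- exact: sa_cst.
- by move=> f g; exact: sa_add.
Qed.

Lemma smooth_laplace_beltrami u : smooth u -> smooth (laplace_beltrami u).
Proof.
move=> su.
have sp i : smooth_alg (partial i u) by exact/sa_smooth/smooth_partial.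
have spp i : smooth_alg (partial i (partial i u)).
  by apply/sa_smooth/smooth_partial/smooth_partial.
(* The square root in [enorm] is not smooth, so its square becomes a polynomial; differences are
   spelled with [-1] to fit the constructors of [smooth_alg]. *)
have -> : laplace_beltrami u = fun x =>
   (1 + (-1) * \sum_i (x ord0 i * x ord0 i)) * (1 + (-1) * \sum_i (x ord0 i * x ord0 i))
     * 4^-1 * (\sum_i partial i (partial i u) x)
   + (n%:R - 2) * ((1 + (-1) * \sum_i (x ord0 i * x ord0 i)) * 2^-1)
       * \sum_i (x ord0 i * partial i u x).
  apply/funext => x; rewrite /laplace_beltrami sqr_enorm /laplacian !mulN1r.
  rewrite -/(dotp x x) -/(sqn x) -expr2; congr (_ + _ * _).
  by rewrite /dotp; apply: eq_bigr => i _; rewrite mxE.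
apply: smooth_alg_smooth.
have s1 : smooth_alg (fun x => 1 + (-1) * \sum_i (x ord0 i * x ord0 i)).
  apply: sa_add; first exact: sa_cst.
  apply: sa_mul; first exact: sa_cst.
  by apply: smooth_alg_sum => i; apply: sa_mul; exact: sa_coord.
apply: sa_add; apply: sa_mul.
- by apply: sa_mul; [exact: sa_mul|exact: sa_cst].
- exact: smooth_alg_sum.
- by apply: sa_mul; [exact: sa_cst|apply: sa_mul; [|exact: sa_cst]].
- by apply: smooth_alg_sum => i; apply: sa_mul => //; exact: sa_coord.
Qed.

Lemma inner_support_near0 f x : inner_support f -> 1 <= sqn x ->
  \forall y \near x, f y = 0.
Proof.
move=> [s0 s1 f0] xs.
have : \forall y \near x, s0 < sqn y.
  by have /cvgr_gt := @sqn_continuous R n x; apply; exact: lt_le_trans xs.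
by apply: filterS => y; exact: f0.
Qed.

Lemma inner_support_partial i u : inner_support u -> inner_support (partial i u).
Proof.
move=> [s0 s1 u0]; exists s0 => // x xs.
have h : \forall y \near x, u y = 0.
  have : \forall y \near x, s0 < sqn y.
    by have /cvgr_gt := @sqn_continuous R n x; apply.
  by apply: filterS => y; exact: u0.
by have [_] := is_derive_near0 (delta_mx ord0 i : 'rV[R]_n) h.
Qed.

Lemma inner_supportMl f u : inner_support f -> inner_support (fun x => f x * u x).
Proof. by move=> [s s1 f0]; exists s => // x /f0 ->; rewrite mul0r. Qed.

Lemma inner_supportD f u : inner_support f -> inner_support u ->
  inner_support (fun x => f x + u x).
Proof.
move=> [s s1 f0] [t t1 u0]; exists (Num.max s t); first by rewrite gt_max s1.
by move=> x; rewrite gt_max => /andP[/f0 -> /u0 ->]; rewrite addr0.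
Qed.

Lemma inner_support_laplace_beltrami u : inner_support u ->
  inner_support (laplace_beltrami u).
Proof.
move=> [s0 s1 u0].
exists s0 => // x xs.
have h : \forall y \near x, u y = 0.
  have : \forall y \near x, s0 < sqn y.
    by have /cvgr_gt := @sqn_continuous R n x; apply.
  by apply: filterS => y; exact: u0.
have p0 i : \forall y \near x, partial i u y = 0.
  have : \forall y \near x, \forall z \near y, u z = 0.
    by apply: nbhs_interior.
  apply: filterS => y hy.
  by have [_] := is_derive_near0 (delta_mx ord0 i : 'rV[R]_n) hy.
rewrite /laplace_beltrami /laplacian big1 ?mulr0 ?add0r; last first.
  by move=> i _; have [_] := is_derive_near0 (delta_mx ord0 i : 'rV[R]_n) (p0 i).
rewrite /dotp big1 ?mulr0// => i _; rewrite mxE.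
by have [_] := is_derive_near0 (delta_mx ord0 i : 'rV[R]_n) h;
  rewrite /partial => ->; rewrite mulr0.
Qed.

Definition inner_smooth f := smooth f /\ inner_support f.

Lemma inner_smooth_iter l f : inner_smooth f ->
  inner_smooth (iter l laplace_beltrami f).
Proof.
move=> [sf kf]; elim: l => [|l [s k]] //=; split.
  exact: smooth_laplace_beltrami.
exact: inner_support_laplace_beltrami.
Qed.

(** The radius is the maximum of [sqn] over the compact support, which is below 1 because it is
    attained in the open ball. An empty support is treated apart. *)
Lemma test_function_inner_smooth f : test_function f -> inner_smooth f.
Proof.
move=> [sf cf Kf]; split => //.
have [/eqP K0|/set0P K0] := boolP (closure [set x | f x != 0] == set0).
  exists 0 => // x _; apply/eqP; apply: contraT => fx.
  suff : closure [set x | f x != 0] x by rewrite K0.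
  exact: subset_closure.
have [c cK hc] := EVT_max_rV K0 cf (continuous_subspaceT sqn_continuous).
exists (sqn c); first by apply/poincare_ballE/Kf; rewrite inE in cK.
move=> x cx; apply/eqP; apply: contraT => fx.
have : x \in closure [set x | f x != 0] by rewrite inE; exact: subset_closure.
by move=> /hc; rewrite leNgt cx.
Qed.

(** The weight [P] is controlled only inside the ball; at every other point [f] vanishes on a whole
    neighbourhood and hides the values of [P]. [continuous_inner_mul] rests on the same remark. *)
Lemma is_derive_inner_mul f (P : 'rV[R]_n -> R) df dP x v :
  inner_support f -> is_derive x v f df ->
  (sqn x < 1 -> is_derive x v P dP) ->
  is_derive x v (fun y => f y * P y) (df * P x + f x * dP).
Proof.
move=> kf hf hP; have [/hP|xs] := ltP (sqn x) 1; first exact: is_derive_mulf.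
have n0 := inner_support_near0 kf xs.
rewrite (inner_support_outside kf xs) mul0r addr0.
rewrite (is_derive_uniq hf (is_derive_near0 v n0)) mul0r.
apply: is_derive_near0; move: n0; apply: filterS => y ->; exact: mul0r.
Qed.

Lemma continuous_inner_mul f (P : 'rV[R]_n -> R) :
  continuous f -> inner_support f ->
  (forall x, sqn x < 1 -> {for x, continuous P}) ->
  continuous (fun y => f y * P y).
Proof.
move=> cf kf cP x; have [/cP h|xs] := ltP (sqn x) 1.
  by apply: continuousM => //; exact: cf.
have n0 := inner_support_near0 kf xs.
rewrite /continuous_at (inner_support_outside kf xs) mul0r.
apply/(@cvgrPdist_lt _ _ _ (nbhs x) (nbhs_filter x)) => e e0.
by move: n0; apply: filterS => y ->; rewrite mul0r subrr normr0.
Qed.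

End smooth_functions.

(** * The distance and its ratio to the Euclidean radius, as functions of one variable *)

Section radial_functions.
Context {R : realType}.
Implicit Types (r s : R).

Lemma is_derive1_continuous_at (f : R -> R) (x d : R) :
  is_derive x 1 f d -> {for x, continuous f}.
Proof. by move=> [h _]; exact/differentiable_continuous/derivable1_diffP. Qed.

Lemma is_derive_eq' (V : normedModType R) (f : V -> R) x v d1 d2 :
  is_derive x v f d1 -> d1 = d2 -> is_derive x v f d2.
Proof. by move=> h <-. Qed.

Lemma is_derive_id1 (x : R) : is_derive x (1 : R) (fun y : R => y) 1.
Proof. exact: is_derive_id. Qed.

(** Twice the inverse hyperbolic tangent, that is, [rho] as a function of the Euclidean radius. *)
Definition artanh2 r : R := ln ((1 + r) / (1 - r)).

Lemma artanh2_0 : artanh2 0 = 0.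
Proof. by rewrite /artanh2 addr0 subr0 divr1 ln1. Qed.

Lemma is_derive_artanh2 r : -1 < r < 1 ->
  is_derive r (1 : R) artanh2 (2 / (1 - r ^+ 2)).
Proof.
move=> /andP[r1 r2].
have p1 : 0 < 1 + r by lra.
have p2 : 0 < 1 - r by lra.
have d1 : is_derive r (1 : R) (fun y => 1 + y) (0 + 1).
  exact: is_derive_addf (is_derive_cstf 1 r 1) (is_derive_id1 r).
have d2 : is_derive r (1 : R) (fun y => 1 - y) (0 - 1).
  exact: is_derive_addf (is_derive_cstf 1 r 1) (is_derive_oppf (is_derive_id1 r)).
have d3 : is_derive r (1 : R) (fun y => ln (1 + y) - ln (1 - y)) (2 / (1 - r ^+ 2)).
  have a1 := is_derive_comp1 (is_derive1_ln p1) d1.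
  have a2 := is_derive_comp1 (f := fun y : R => 1 - y) (is_derive1_ln p2) d2.
  have a3 := is_derive_addf a1 (is_derive_oppf a2).
  apply: (is_derive_eq' a3).
  have q1 := lt0r_neq0 p1; have q2 := lt0r_neq0 p2.
  have q3 : 1 - r ^+ 2 != 0 by rewrite (_ : 1 - r ^+ 2 = (1 + r) * (1 - r)) ?mulf_neq0//; ring.
  by field; rewrite q3 q2 q1.
apply: near_eq_is_derive d3.
have h1 : \forall y \near r, -1 < y by exact: lt_nbhsr.
have h2 : \forall y \near r, y < 1 by exact: lt_nbhsl.
apply: filterS2 h1 h2 => y y1 y2.
by rewrite /artanh2 ln_div// posrE; lra.
Qed.

(** Mean value theorem from 0: the derivative [2 / (1 - c^2)] at an intermediate point lies between
    its values at 0 and at [r]. *)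
Lemma artanh2_bounds r : 0 <= r < 1 ->
  2 * r <= artanh2 r <= 2 * r / (1 - r ^+ 2).
Proof.
move=> /andP[r0 r1].
have dr (x : R) : 0 <= x <= r -> is_derive x (1 : R) artanh2 (2 / (1 - x ^+ 2)).
  by move=> /andP[x0 xr]; apply: is_derive_artanh2; lra.
have [||c] := @MVT_segment R artanh2 (fun x => 2 / (1 - x ^+ 2)) 0 r r0.
- by move=> x; rewrite in_itv /= => /andP[x0 xr]; apply: dr; lra.
- apply: derivable_within_continuous => x; rewrite in_itv /= => /dr.
  by case.
rewrite in_itv /= artanh2_0 !subr0 => /andP[c0 cr] ->.
have s1 : 0 < 1 - r ^+ 2 by nra.
have c2 : c ^+ 2 <= r ^+ 2 by nra.
have s2 : 0 < 1 - c ^+ 2 by lra.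
apply/andP; split.
  rewrite ler_wpM2r// ler_pdivlMr//; nra.
rewrite [leRHS]mulrAC ler_wpM2r// ler_wpM2l// lef_pV2 ?posrE//; lra.
Qed.

(* The ratio rho / |x| as a function of s = |x|^2, extended by its limit 2. *)
Definition mrad s : R := if 0 < s then artanh2 (Num.sqrt s) / Num.sqrt s else 2.

Lemma sqrt_lt1 s : 0 < s < 1 -> 0 < Num.sqrt s < 1.
Proof.
move=> /andP[s0 s1]; rewrite sqrtr_gt0 s0 /=.
by rewrite -[ltRHS]sqrtr1 ltr_sqrt.
Qed.

(** The second alternative serves the squeeze at 0, which is two-sided although only [s >= 0] has a
    geometric meaning. *)
Lemma mrad_bounds s : s < 1 -> 2 <= mrad s <= 2 / (1 - `|s|) \/ s < 0 /\ mrad s = 2.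
Proof.
move=> s1; rewrite /mrad; case: ltP => s0.
  left; have /sqrt_lt1/andP[r0 r1] : 0 < s < 1 by rewrite s0.
  have /andP[] : 2 * Num.sqrt s <= artanh2 (Num.sqrt s) <=
    2 * Num.sqrt s / (1 - Num.sqrt s ^+ 2) by apply: artanh2_bounds; lra.
  rewrite (sqr_sqrtr (ltW s0)) (gtr0_norm s0) => h1 h2.
  rewrite ler_pdivlMr// h1 ler_pdivrMr// mulrAC.
  by rewrite h2.
case: (ltgtP s 0) s0 => // [s0 _|-> _]; first by right.
by left; rewrite normr0 subr0 divr1; lra.
Qed.

Lemma mrad_ge2 s : s < 1 -> 2 <= mrad s.
Proof. by case/mrad_bounds => [/andP[]//|[_ ->]]. Qed.

Lemma mrad_le s : 0 <= s < 1 -> mrad s <= 2 / (1 - s).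
Proof.
move=> /andP[s0 /mrad_bounds[/andP[_]|[]]]; first by rewrite ger0_norm.
by rewrite ltNge s0.
Qed.

Lemma mrad0 : mrad 0 = 2. Proof. by rewrite /mrad ltxx. Qed.

Lemma is_derive_mrad s : 0 < s < 1 ->
  is_derive s (1 : R) mrad ((2 / (1 - s) - mrad s) / (2 * s)).
Proof.
move=> s01; have /andP[s0 s1] := s01; have /andP[r0 r1] := sqrt_lt1 s01.
have sq : Num.sqrt s ^+ 2 = s by rewrite sqr_sqrtr// ltW.
have ds := is_derive1_sqrt s0.
have rn := lt0r_neq0 r0.
have r2 : -1 < Num.sqrt s < 1 by lra.
have dA := is_derive_comp1 (is_derive_artanh2 r2) ds.
have dI := is_deriveV rn ds.
apply: (@near_eq_is_derive _ _ _ (fun y => artanh2 (Num.sqrt y) * (Num.sqrt y)^-1)).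
- have h1 : \forall y \near s, 0 < y by exact: lt_nbhsr.
  by apply: filterS h1 => y y0; rewrite /mrad y0.
apply: (is_derive_eq' (is_derive_mulf dA dI)).
rewrite /mrad s0 sq /GRing.scale /=.
have vn : 1 - s != 0 by apply: lt0r_neq0; lra.
have gen (A t y : R) : t ^+ 2 = y -> t != 0 -> 1 - y != 0 ->
    2 / (1 - y) * (2 * t)^-1 * t^-1 + A * (- y^-1 * (2 * t)^-1) =
    (2 / (1 - y) - A / t) / (2 * y).
  by move=> <- t0 y0; field; rewrite t0 y0.
exact: gen.
Qed.

Lemma mrad_continuous s : 0 <= s < 1 -> {for s, continuous mrad}.
Proof.
move=> /andP[]; rewrite le_eqVlt => /predU1P[<- _|s0 s1]; last first.
  by apply: is_derive1_continuous_at; apply: is_derive_mrad; rewrite s0.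
suff : mrad y @[y --> (0 : R)] --> (2 : R) by rewrite -[X in _ --> X]mrad0.
apply: (@squeeze_cvgr _ _ _ _ (fun=> 2) (fun s => 2 / (1 - `|s|))).
- have h1 : \forall y \near (0 : R), `|y| < 1.
    apply: (@cvgr0_norm_lt R R^o R (nbhs (0:R)) _ id) => //.
  apply: filterS h1 => y /[dup] y1; rewrite ltr_norml => /andP[y2 y3].
  have [//|[y0 ->]] := mrad_bounds y3.
  by rewrite lexx /= ler_pdivlMr; have := normr_ge0 y; lra.
- exact: cvg_cst.
- have E : 2 / (1 - `|0 : R|) = 2 by rewrite normr0 subr0 divr1.
  rewrite -[X in _ --> X]E.
  apply: cvgM; first exact: cvg_cst.
  apply: cvgV; first by rewrite normr0 subr0 oner_neq0.
  by apply: cvgB; [exact: cvg_cst|exact: norm_continuous].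
Qed.

(** Where [f] vanishes, the difference quotient of the product is that of [f] times [k], so
    continuity of [k] suffices. This replaces differentiability of [mrad] at the origin. *)
Lemma is_derive_mul_vanishing (V : normedModType R) (f k : V -> R) x v d :
  f x = 0 -> is_derive x v f d -> {for x, continuous k} ->
  is_derive x v (fun y => f y * k y) (d * k x).
Proof.
move=> fx0 [df fd] kx.
have kl : (fun h : R => k (h *: v + x)) @ 0^' --> k x.
  have hx : (fun h : R => h *: v + x) @ 0^' --> x.
    apply: cvg_within_filter.
    have : (fun h : R => h *: v + x) @ (0 : R) --> 0 *: v + x.
      by apply: cvgD; [apply: cvgZr_tmp; exact: cvg_id|exact: cvg_cst].
    by rewrite scale0r add0r.
  exact: cvg_comp hx kx.
have lim0 : (fun h : R => h^-1 *: (f (h *: v + x) * k (h *: v + x) - f x * k x)) @ 0^'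
    --> d * k x.
  have -> : (fun h : R => h^-1 *: (f (h *: v + x) * k (h *: v + x) - f x * k x)) =
     (fun h : R => h^-1 *: (f (h *: v + x) - f x)) \* (fun h => k (h *: v + x)).
    by apply/funext => h; rewrite /= fx0 mul0r !subr0 scalerAl.
  by apply: cvgM kl; rewrite -fd; exact: df.
split; first by apply/cvg_ex; exists (d * k x).
exact: cvg_lim.
Qed.

End radial_functions.

(** * The algebraic identities behind the Rellich and Hardy inequalities *)

Section pointwise_inequalities.
Context {R : realFieldType}.

(* The integrand of the Rellich defect, modulo a divergence, is a sum of two
   squares and of a term that is nonnegative thanks to the regularisation. *)
Lemma rellich_pointwise (n g a f N X L s m v u U w d : R) :
  2 < n -> 0 < g -> g < n - 2 -> a = (n - 2 - g) / 2 ->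
  s = 1 - v^-1 -> 0 < v -> u = s * m ^+ 2 + d -> 0 <= d -> 0 < u ->
  0 <= U -> 0 <= w ->
  (forall t : R, 0 <= N + 2 * t * X + t ^+ 2 * s) ->
  let K := a * (a + g) in
  let LB := L / (4 * v ^+ 2) + (n - 2) / (2 * v) * X in
  let H := m * (1 + s) / 2 - 1 in
  let W := 4 * w * v ^+ 2 in
  let A := U * u * w in
  let dA := (- g / 2) * U * (2 * m * v) * w + U * u * ((n - 2) * v * w) in
  let B := U * w * (2 * v) in
  let dB := (- g / 2 - 1) * (U / u) * (2 * m * v) * w * (2 * v)
     + U * ((n - 2) * v * w) * (2 * v) + U * w * (2 * v ^+ 2) in
  is_true (K ^+ 2 * (f ^+ 2 * (U * W))
    + K * (n - 2) * (n - 1) * (H * (f ^+ 2 * (U * W)))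
    + ((- (2 * K)) * (A * N + f * (2 * dA * X + A * L))
       + (- (K * (n - 2))) * (2 * f * B * m * X
           + f ^+ 2 * (2 * s * m * dB + B * ((n - 1) * m + 2 * v))))
    <= LB ^+ 2 * (U * u ^+ 2 * W)).
Proof.
move=> n2 g0 gn aE sE v0 uE d0 u0 U0 w0 CS K LB H W A dA B dB.
have K0 : 0 <= K by rewrite /K aE; nra.
have un := lt0r_neq0 u0; have vn := lt0r_neq0 v0.
rewrite -subr_ge0.
(* The inner sum of the second term is [|grad f + lambda f x|^2] with [lambda = 2 a m v / u]. Since
   [rho^2] has Euclidean gradient [4 m v x], it vanishes exactly on multiples of [u^(-a/2)]. *)
have -> : LB ^+ 2 * (U * u ^+ 2 * W) -
  (K ^+ 2 * (f ^+ 2 * (U * W)) + K * (n - 2) * (n - 1) * (H * (f ^+ 2 * (U * W)))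
  + ((- (2 * K)) * (A * N + f * (2 * dA * X + A * L))
     + (- (K * (n - 2))) * (2 * f * B * m * X
         + f ^+ 2 * (2 * s * m * dB + B * ((n - 1) * m + 2 * v)))))
  = W * U * (u * LB + K * f) ^+ 2
    + 2 * K * w * U * u * (N + 2 * (2 * a * m * v / u * f) * X
          + (2 * a * m * v / u * f) ^+ 2 * s)
    + 2 * K * f ^+ 2 * W * U / u * d * ((n - 2) / 2 * n - K).
  have -> : d = u - s * m ^+ 2 by rewrite uE; ring.
  rewrite /A /dA /B /dB /W /H /LB /K aE sE.
  field.
  by rewrite un vn.
have W0 : 0 <= W by rewrite /W !mulr_ge0 ?exprn_ge0 ?(ltW v0).
(* Sign of the term carrying [d]: here [4K = (n-2)^2 - g^2], well below [2n(n-2)]. *)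
have c0 : 0 <= (n - 2) / 2 * n - K by rewrite /K aE; nra.
have ui : 0 <= u^-1 by rewrite invr_ge0 ltW.
have u0' := ltW u0.
have p2 : (0 : R) <= 2 by [].
apply: addr_ge0; first apply: addr_ge0;
  repeat first [exact: sqr_ge0|assumption|exact: CS|apply: mulr_ge0].

Qed.

(** A single square, [|grad f + lambda f x|^2] with [lambda = 2 a m v / u], is completed. The two
    leftover terms, one carrying [d] and one carrying [rho coth rho - 1], are nonnegative and are
    discarded, since the remainder of the theorem is supplied by the Rellich steps. *)
Lemma hardy_pointwise (n b a f N X s m v u U w d : R) :
  -2 < b -> b < n - 2 -> a = (n - 2 - b) / 2 ->
  s = 1 - v^-1 -> 0 < v -> u = s * m ^+ 2 + d -> 0 <= d -> 0 < u ->
  0 <= U -> 0 <= w -> 0 <= m * (1 + s) / 2 - 1 -> 1 <= n ->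
  (forall t : R, 0 <= N + 2 * t * X + t ^+ 2 * s) ->
  let W := 4 * w * v ^+ 2 in
  let B := U * w * (2 * v) in
  let dB := (- b / 2 - 1) * (U / u) * (2 * m * v) * w * (2 * v)
     + U * ((n - 2) * v * w) * (2 * v) + U * w * (2 * v ^+ 2) in
  is_true (a ^+ 2 * (f ^+ 2 * (U * W))
    + ((- a) * (2 * f * B * m * X
           + f ^+ 2 * (2 * s * m * dB + B * ((n - 1) * m + 2 * v))))
    <= N / (4 * v ^+ 2) * (U * u * W)).
Proof.
move=> b2 bn aE sE v0 uE d0 u0 U0 w0 H0 n1 CS W B dB.
have un := lt0r_neq0 u0; have vn := lt0r_neq0 v0.
rewrite -subr_ge0.
have -> : N / (4 * v ^+ 2) * (U * u * W) - (a ^+ 2 * (f ^+ 2 * (U * W))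
  + ((- a) * (2 * f * B * m * X
         + f ^+ 2 * (2 * s * m * dB + B * ((n - 1) * m + 2 * v)))))
  = w * U * u * (N + 2 * (2 * a * m * v / u * f) * X
          + (2 * a * m * v / u * f) ^+ 2 * s)
    + f ^+ 2 * W * U / u * d * (a * (n - a))
    + a * (n - 1) * (m * (1 + s) / 2 - 1) * (f ^+ 2 * (U * W)).
  have -> : d = u - s * m ^+ 2 by rewrite uE; ring.
  rewrite /B /dB /W aE sE.
  field.
  by rewrite un vn.
have W0 : 0 <= W by rewrite /W !mulr_ge0 ?exprn_ge0 ?(ltW v0).
have a0 : 0 <= a by rewrite aE; lra.
have na : 0 <= n - a by rewrite aE; lra.
have ui : 0 <= u^-1 by rewrite invr_ge0 ltW.
have u0' := ltW u0.
have n1' : 0 <= n - 1 by rewrite subr_ge0.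
apply: addr_ge0; first apply: addr_ge0;
  repeat first [exact: sqr_ge0|assumption|exact: CS|apply: mulr_ge0].

Qed.

End pointwise_inequalities.

Section continuity_rules.
Context {R : realType} {T : topologicalType}.
Implicit Types (f g : T -> R) (x : T).

Lemma continuous_at_add f g x : {for x, continuous f} -> {for x, continuous g} ->
  {for x, continuous (fun y => f y + g y)}.
Proof. exact: continuousD. Qed.

Lemma continuous_at_mul f g x : {for x, continuous f} -> {for x, continuous g} ->
  {for x, continuous (fun y => f y * g y)}.
Proof. exact: continuousM. Qed.

Lemma continuous_at_cst (c : R) x : {for x, continuous (fun _ : T => c)}.
Proof. exact: cst_continuous. Qed.

Lemma continuous_at_exp f m x : {for x, continuous f} ->
  {for x, continuous (fun y => f y ^+ m)}.
Proof.
move=> cf; elim: m => [|m IH].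
  exact: continuous_at_cst.
rewrite (_ : (fun y => f y ^+ m.+1) = (fun y => f y * f y ^+ m)).
  exact: continuous_at_mul.
by apply/funext => y; rewrite exprS.
Qed.

Lemma continuous_at_inv f x : f x != 0 -> {for x, continuous f} ->
  {for x, continuous (fun y => (f y)^-1)}.
Proof. exact: continuousV. Qed.

End continuity_rules.

(** * Regularised radial weights as functions of [s = |x|^2], with their derivatives *)

Section radial_weights.
Context {R : realType}.
Variables (d e : R) (k : nat).
Hypothesis d0 : 0 < d.
Implicit Types s : R.

Definition ureg s := s * mrad s ^+ 2 + d.
Definition upow s := ureg s `^ e.
Definition vrad s : R := (1 - s)^-1.
(** Applied with [k = n - 2]: the metric has conformal factor [2v], so [Delta_g f] times the volume
    density is the Euclidean divergence of [(2v)^(n-2) grad f]. *)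
Definition wrad s : R := (2 * vrad s) ^+ k.
Definition Arad s := upow s * ureg s * wrad s.
Definition dArad s := (e + 1) * upow s * (2 * mrad s * vrad s) * wrad s
  + upow s * ureg s * (k%:R * vrad s * wrad s).
(** The field [Brad * mrad * x] is [upow * wrad] times half the gradient of [rho^2]. The factor
    [mrad] is left out so that it can be paired with a coordinate, the product being differentiable
    at the origin. *)
Definition Brad s := upow s * wrad s * (2 * vrad s).
Definition dBrad s :=
  e * (upow s / ureg s) * (2 * mrad s * vrad s) * wrad s * (2 * vrad s)
  + upow s * (k%:R * vrad s * wrad s) * (2 * vrad s)
  + upow s * wrad s * (2 * vrad s ^+ 2).

Lemma ureg_gt0 s : 0 <= s -> 0 < ureg s.
Proof. by move=> s0; rewrite ltr_wpDl// mulr_ge0// sqr_ge0. Qed.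

Lemma vrad_gt0 s : s < 1 -> 0 < vrad s.
Proof. by move=> s1; rewrite invr_gt0 subr_gt0. Qed.

Lemma is_derive_sqr_mrad s : 0 <= s < 1 ->
  is_derive s (1 : R) (fun y => y * mrad y ^+ 2) (2 * mrad s * vrad s).
Proof.
move=> s01; have /andP[] := s01; rewrite le_eqVlt => /predU1P[<- _|s0 s1].
  have c : {for (0 : R), continuous (fun y : R => mrad y ^+ 2)}.
    by apply: continuous_at_exp; apply: mrad_continuous; lra.
  apply: (is_derive_eq' (is_derive_mul_vanishing (f := fun y : R => y) erefl (is_derive_id1 0) c)).
  by rewrite mrad0 /vrad subr0 invr1; ring.
have dm : is_derive s (1 : R) mrad ((2 / (1 - s) - mrad s) / (2 * s)).
  by apply: is_derive_mrad; rewrite s0.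
have D := is_derive_mulf (is_derive_id1 s) (is_derive_mulf dm dm).
rewrite (_ : (fun y => y * mrad y ^+ 2) = (fun y => y * (mrad y * mrad y))); last first.
  by apply/funext => y; rewrite expr2.
apply: (is_derive_eq' D); rewrite /vrad.
have sn := lt0r_neq0 s0; have vn : 1 - s != 0 by apply: lt0r_neq0; lra.
by field; rewrite sn vn.
Qed.

Lemma is_derive_ureg s : 0 <= s < 1 ->
  is_derive s (1 : R) ureg (2 * mrad s * vrad s).
Proof.
move=> s01.
apply: (is_derive_eq' (is_derive_addf (is_derive_sqr_mrad s01) (is_derive_cstf d s 1))).
by rewrite addr0.
Qed.

Lemma is_derive_upow s : 0 <= s < 1 ->
  is_derive s (1 : R) upow (e * (upow s / ureg s) * (2 * mrad s * vrad s)).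
Proof.
move=> s01; have u0 : 0 < ureg s by case/andP: s01 => /ureg_gt0.
apply: (is_derive_eq' (is_derive_comp1 (is_derive1_powR e u0) (is_derive_ureg s01))).
by rewrite /upow powRD ?(lt0r_neq0 u0) ?implybT// powR_inv1// ltW.
Qed.

Lemma is_derive_vrad s : s < 1 -> is_derive s (1 : R) vrad (vrad s ^+ 2).
Proof.
move=> s1; have vn : 1 - s != 0 by apply: lt0r_neq0; lra.
have D : is_derive s (1 : R) (fun y => 1 - y) (0 - 1).
  exact: is_derive_addf (is_derive_cstf 1 s 1) (is_derive_oppf (is_derive_id1 s)).
have := is_deriveV (f := fun y : R => 1 - y) vn D.
by move=> h; apply: (is_derive_eq' h); rewrite /vrad /GRing.scale /=; field.
Qed.

Lemma is_derive_wrad s : s < 1 ->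
  is_derive s (1 : R) wrad (k%:R * vrad s * wrad s).
Proof.
move=> s1; rewrite /wrad; elim: k => [|j IH].
  apply: (is_derive_eq' (is_derive_cstf 1 s 1)).
  by rewrite !mul0r.
have D := is_derive_mulf (is_derive_mulf (is_derive_cstf 2 s 1) (is_derive_vrad s1)) IH.
rewrite (_ : (fun y => (2 * vrad y) ^+ j.+1) = (fun y => 2 * vrad y * (2 * vrad y) ^+ j)); last first.
  by apply/funext => y; rewrite exprS.
by apply: (is_derive_eq' D); rewrite [(2 * vrad s) ^+ j.+1]exprS -natr1; ring.
Qed.

Lemma is_derive_Arad s : 0 <= s < 1 -> is_derive s (1 : R) Arad (dArad s).
Proof.
move=> s01; have /andP[s0 s1] := s01.
have un := lt0r_neq0 (ureg_gt0 s0).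
apply: (is_derive_eq' (is_derive_mulf (is_derive_mulf (is_derive_upow s01) (is_derive_ureg s01)) (is_derive_wrad s1))).
by rewrite /dArad; field.
Qed.

Lemma is_derive_Brad s : 0 <= s < 1 -> is_derive s (1 : R) Brad (dBrad s).
Proof.
move=> s01; have /andP[s0 s1] := s01.
have un := lt0r_neq0 (ureg_gt0 s0).
apply: (is_derive_eq' (is_derive_mulf (is_derive_mulf (is_derive_upow s01) (is_derive_wrad s1))
  (is_derive_mulf (is_derive_cstf 2 s 1) (is_derive_vrad s1)))).
by rewrite /dBrad; field.
Qed.

Lemma ureg_continuous s : 0 <= s < 1 -> {for s, continuous ureg}.
Proof. by move=> h; exact: is_derive1_continuous_at (is_derive_ureg h). Qed.

Lemma upow_continuous s : 0 <= s < 1 -> {for s, continuous upow}.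
Proof. by move=> h; exact: is_derive1_continuous_at (is_derive_upow h). Qed.

Lemma vrad_continuous s : 0 <= s < 1 -> {for s, continuous vrad}.
Proof. by move=> /andP[_ h]; exact: is_derive1_continuous_at (is_derive_vrad h). Qed.

Lemma wrad_continuous s : 0 <= s < 1 -> {for s, continuous wrad}.
Proof. by move=> /andP[_ h]; exact: is_derive1_continuous_at (is_derive_wrad h). Qed.

Lemma Arad_continuous s : 0 <= s < 1 -> {for s, continuous Arad}.
Proof. by move=> h; exact: is_derive1_continuous_at (is_derive_Arad h). Qed.

Lemma Brad_continuous s : 0 <= s < 1 -> {for s, continuous Brad}.
Proof. by move=> h; exact: is_derive1_continuous_at (is_derive_Brad h). Qed.

End radial_weights.

Section radial_weights_continuity.
Context {R : realType}.
Variables (d e : R) (k : nat) (s : R).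
Hypotheses (d0 : 0 < d) (s01 : 0 <= s < 1).

Let cm := mrad_continuous s01.
Let cu := @ureg_continuous R d s s01.
Let cp := @upow_continuous R d e d0 s s01.
Let cv := vrad_continuous s01.
Let cw := @wrad_continuous R k s s01.

Local Notation cA := continuous_at_add.
Local Notation cM := continuous_at_mul.
Local Notation cC := (fun c => @continuous_at_cst R R c s).

Lemma dArad_continuous : {for s, continuous (dArad d e k)}.
Proof.
exact: (cA (cM (cM (cM (cC (e + 1)) cp) (cM (cM (cC 2) cm) cv)) cw)
  (cM (cM cp cu) (cM (cM (cC k%:R) cv) cw))).
Qed.

Lemma dBrad_continuous : {for s, continuous (dBrad d e k)}.
Proof.
have ci : {for s, continuous (fun y => (ureg d y)^-1)}.
  apply: continuous_at_inv => //.
  by case/andP: s01 => /(ureg_gt0 d0)/lt0r_neq0.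
exact: (cA (cA (cM (cM (cM (cM (cC e) (cM cp ci)) (cM (cM (cC 2) cm) cv)) cw)
    (cM (cC 2) cv))
  (cM (cM cp (cM (cM (cC k%:R) cv) cw)) (cM (cC 2) cv)))
  (cM (cM cp cw) (cM (cC 2) (@continuous_at_exp _ _ _ 2%N _ cv)))).
Qed.

End radial_weights_continuity.

(** * Divergence of the vector fields built from radial weights *)

Section radial_on_ball.
Context {R : realType} {n : nat}.
Implicit Types (f : 'rV[R]_n -> R) (x : 'rV[R]_n) (i : 'I_n).
Local Notation ee i := (delta_mx ord0 i : 'rV[R]_n).

Lemma sqn_ball x : sqn x < 1 -> 0 <= sqn x < 1.
Proof. by move=> ->; rewrite sqn_ge0. Qed.

Lemma is_derive_sqn x i : is_derive x (ee i) (@sqn R n) (2 * x ord0 i).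
Proof.
have dj (j : 'I_n) : is_derive x (ee i) (fun y : 'rV[R]_n => y ord0 j * y ord0 j)
    (2 * (x ord0 j *+ (j == i))).
  have D := is_derive_coord j x (ee i).
  apply: (is_derive_eq' (is_derive_mulf D D)).
  by rewrite !mxE eqxx /=; case: (j == i); rewrite ?mulr1n ?mulr0n /=; ring.
rewrite (_ : sqn = \sum_j (fun y : 'rV[R]_n => y ord0 j * y ord0 j)); last first.
  by apply/funext => y; rewrite fct_sumE.
apply: (is_derive_eq' (is_derive_sum dj)).
rewrite -mulr_sumr (bigD1 i)//= eqxx big1 ?addr0// => j /negbTE ->.
by rewrite mulr0n.
Qed.

Lemma is_derive_radial (P : R -> R) dP x i : is_derive (sqn x) (1 : R) P dP ->
  is_derive x (ee i) (fun y => P (sqn y)) (dP * (2 * x ord0 i)).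
Proof. by move=> hP; exact: is_derive_comp1 hP (is_derive_sqn x i). Qed.

Lemma continuous_radial (P : R -> R) x : {for sqn x, continuous P} ->
  {for x, continuous (fun y : 'rV[R]_n => P (sqn y))}.
Proof. by move=> cP; apply: continuous_comp cP; exact: sqn_continuous. Qed.

Lemma sqn_eq0_coord x i : sqn x = 0 -> x ord0 i = 0.
Proof.
move=> s0; have := sqr_coord_le_sqn x i; rewrite s0 => h.
by apply/eqP; rewrite -sqrf_eq0 eq_le h sqr_ge0.
Qed.

Lemma sqn_eq0 x : sqn x = 0 -> x = 0.
Proof. by move=> s0; apply/rowP => i; rewrite sqn_eq0_coord// mxE. Qed.

(* Here 0 / 0 = 0 is the right value: the bracket vanishes at the origin. *)
Definition coord_mrad_deriv i x : R :=
  mrad (sqn x) + x ord0 i ^+ 2 / sqn x * (2 * vrad (sqn x) - mrad (sqn x)).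

Lemma is_derive_coord_mrad x i : sqn x < 1 ->
  is_derive x (ee i) (fun y : 'rV[R]_n => y ord0 i * mrad (sqn y))
    (coord_mrad_deriv i x).
Proof.
move=> x1; have x01 := sqn_ball x1.
have dx := is_derive_coord i x (ee i).
have e1 : (ee i) ord0 i = 1 by rewrite mxE !eqxx.
have [s0|s0] := eqVneq (sqn x) 0.
  have cm : {for x, continuous (fun y : 'rV[R]_n => mrad (sqn y))}.
    by apply: continuous_radial; exact: mrad_continuous.
  apply: (is_derive_eq' (is_derive_mul_vanishing (sqn_eq0_coord i s0) dx cm)).
  by rewrite /coord_mrad_deriv s0 e1 invr0 mulr0 mul0r addr0 mul1r.
have sp : 0 < sqn x < 1 by rewrite lt_neqAle eq_sym s0 sqn_ge0.
apply: (is_derive_eq' (is_derive_mulf dx (is_derive_radial i (is_derive_mrad sp)))).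
have vn : 1 - sqn x != 0 by apply: lt0r_neq0; lra.
by rewrite /coord_mrad_deriv e1 /vrad; field; rewrite s0 vn.
Qed.

(** At the origin the ratio [x_i^2 / |x|^2] has no limit, but it stays in [[0, 1]] while the factor
    [2v - m] tends to 0. *)
Lemma coord_mrad_deriv_continuous x i : sqn x < 1 ->
  {for x, continuous (coord_mrad_deriv i)}.
Proof.
move=> x1; have x01 := sqn_ball x1.
have cm : {for x, continuous (fun y : 'rV[R]_n => mrad (sqn y))}.
  by apply: continuous_radial; exact: mrad_continuous.
have cv : {for x, continuous (fun y : 'rV[R]_n => vrad (sqn y))}.
  by apply: continuous_radial; exact: vrad_continuous.
have cg : {for x, continuous (fun y : 'rV[R]_n => 2 * vrad (sqn y) - mrad (sqn y))}.
  apply: continuousB cm.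
  exact: continuous_at_mul (@continuous_at_cst R _ 2 x) cv.
apply: (continuous_at_add cm).
have [s0|s0] := eqVneq (sqn x) 0; last first.
  apply: continuous_at_mul cg; apply: continuous_at_mul.
    by apply: continuous_at_exp; exact: coord_continuous.
  by apply: continuous_at_inv => //; exact: sqn_continuous.
have g0 : 2 * vrad (sqn x) - mrad (sqn x) = 0.
  by rewrite s0 mrad0 /vrad subr0 invr1 mulr1 subrr.
rewrite /prop_for /continuous_at /= g0 mulr0.
apply/(@cvgrPdist_lt _ _ _ (nbhs x) (nbhs_filter x)) => e e0.
have : \forall y \near x, `|0 - (2 * vrad (sqn y) - mrad (sqn y))| < e.
  by move/(@cvgrPdist_lt _ _ _ (nbhs x) (nbhs_filter x)): cg; rewrite g0; apply.
apply: filterS => y; apply: le_lt_trans.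
rewrite !sub0r !normrN normrM ler_piMl//.
have [->|sy] := eqVneq (sqn y) 0; first by rewrite invr0 mulr0 normr0.
rewrite ger0_norm ?divr_ge0 ?sqr_ge0 ?sqn_ge0//.
rewrite ler_pdivrMr ?mul1r ?sqr_coord_le_sqn//.
by rewrite lt_neqAle eq_sym sy sqn_ge0.
Qed.

Lemma sum_coord_mrad_deriv x : sqn x < 1 ->
  \sum_i coord_mrad_deriv i x =
  (n%:R - 1) * mrad (sqn x) + 2 * vrad (sqn x).
Proof.
move=> x1; rewrite /coord_mrad_deriv big_split /= sumr_const card_ord.
rewrite -mulr_suml -mulr_suml.
have -> : \sum_i x ord0 i ^+ 2 = sqn x.
  by apply: eq_bigr => i _; rewrite expr2.
(* At the origin the ratio term drops out; [m = 2] and [v = 1] make [n m] agree with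
   [(n-1) m + 2v]. *)
have [->|s0] := eqVneq (sqn x) 0.
  rewrite mrad0 /vrad subr0 invr1 invr0 -mulr_natl; ring.
by rewrite -mulr_natl divff//; ring.
Qed.

Definition grad_sqr f x : R := \sum_i partial i f x ^+ 2.
Definition euler f x : R := \sum_i x ord0 i * partial i f x.

Lemma grad_euler_ge0 f x t :
  0 <= grad_sqr f x + 2 * t * euler f x + t ^+ 2 * sqn x.
Proof.
have -> : grad_sqr f x + 2 * t * euler f x + t ^+ 2 * sqn x =
   \sum_i (partial i f x + t * x ord0 i) ^+ 2.
  rewrite /grad_sqr /euler /sqn /dotp !mulr_sumr -!big_split /=.
  by apply: eq_bigr => i _; ring.
by apply: sumr_ge0 => i _; exact: sqr_ge0.
Qed.

Section radial_compare.
Variables (d e al ka : R) (k : nat) (f : 'rV[R]_n -> R).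
Hypotheses (d0 : 0 < d) (hf : inner_smooth f).

Let sf : smooth f := hf.1.
Let kf : inner_support f := hf.2.

Let A x := Arad d e k (sqn x).
Let dA x := dArad d e k (sqn x).
Let B x := Brad d e k (sqn x).
Let dB x := dBrad d e k (sqn x).

(** The test field is [Y = f Q]. Keeping [f] as an outer factor lets its support handle the points
    outside the ball, so [Q] needs to be differentiated only inside. *)
Let Q i x := al * (A x * partial i f x)
  + ka * (f x * (B x * (x ord0 i * mrad (sqn x)))).
Let dQ i x :=
  al * (dA x * (2 * x ord0 i) * partial i f x + A x * partial i (partial i f) x)
  + ka * (partial i f x * (B x * (x ord0 i * mrad (sqn x)))
          + f x * (dB x * (2 * x ord0 i) * (x ord0 i * mrad (sqn x))
                   + B x * coord_mrad_deriv i x)).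
Let Y i x := f x * Q i x.
Let dY i x := partial i f x * Q i x + f x * dQ i x.

Let is_derive_Q i x : sqn x < 1 -> is_derive x (ee i) (Q i) (dQ i x).
Proof.
move=> x1; have x01 := sqn_ball x1.
have DA := is_derive_radial i (is_derive_Arad e k d0 x01).
have DB := is_derive_radial i (is_derive_Brad e k d0 x01).
have Dp := smooth_is_derive i x (smooth_partial i sf).
have Df := smooth_is_derive i x sf.
have DE := is_derive_coord_mrad i x1.
have D1 := is_derive_mulf (is_derive_cstf al x (ee i)) (is_derive_mulf DA Dp).
have D2 := is_derive_mulf (is_derive_cstf ka x (ee i))
  (is_derive_mulf Df (is_derive_mulf DB DE)).
apply: (is_derive_eq' (is_derive_addf D1 D2)).
by rewrite /dQ /A /B /dA /dB !mul0r !add0r.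
Qed.

Let is_derive_Y i x : is_derive x (ee i) (Y i) (dY i x).
Proof.
apply: is_derive_inner_mul kf (smooth_is_derive i x sf) _.
exact: is_derive_Q.
Qed.

Let cQ i x : sqn x < 1 -> {for x, continuous (Q i)}.
Proof.
move=> x1; have x01 := sqn_ball x1.
have cA : {for x, continuous A} := continuous_radial (Arad_continuous d0 x01).
have cB : {for x, continuous B} := continuous_radial (Brad_continuous d0 x01).
have cp := smooth_continuous (smooth_partial i sf) (x := x).
have cf := smooth_continuous sf (x := x).
have cx := @coord_continuous R 1 n ord0 i x.
have cm : {for x, continuous (fun y : 'rV[R]_n => mrad (sqn y))}.
  by apply: continuous_radial; exact: mrad_continuous.
apply: continuous_at_add; apply: continuous_at_mul.
- exact: continuous_at_cst.
- exact: continuous_at_mul cA cp.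
- exact: continuous_at_cst.
- exact: continuous_at_mul cf (continuous_at_mul cB (continuous_at_mul cx cm)).
Qed.

Let cdQ i x : sqn x < 1 -> {for x, continuous (dQ i)}.
Proof.
move=> x1; have x01 := sqn_ball x1.
have cA : {for x, continuous A} := continuous_radial (Arad_continuous d0 x01).
have cB : {for x, continuous B} := continuous_radial (Brad_continuous d0 x01).
have cdA : {for x, continuous dA} := continuous_radial (dArad_continuous d0 x01).
have cdB : {for x, continuous dB} := continuous_radial (dBrad_continuous d0 x01).
have cp := smooth_continuous (smooth_partial i sf) (x := x).
have cpp := smooth_continuous (smooth_partial i (smooth_partial i sf)) (x := x).
have cf := smooth_continuous sf (x := x).
have cx := @coord_continuous R 1 n ord0 i x.
have cm : {for x, continuous (fun y : 'rV[R]_n => mrad (sqn y))}.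
  by apply: continuous_radial; exact: mrad_continuous.
have cE : {for x, continuous (coord_mrad_deriv i)} := coord_mrad_deriv_continuous x1.
have c2x := continuous_at_mul (@continuous_at_cst R _ 2 x) cx.
have cxm := continuous_at_mul cx cm.
apply: continuous_at_add; apply: continuous_at_mul.
- exact: continuous_at_cst.
- exact: continuous_at_add (continuous_at_mul (continuous_at_mul cdA c2x) cp)
    (continuous_at_mul cA cpp).
- exact: continuous_at_cst.
- exact: continuous_at_add (continuous_at_mul cp (continuous_at_mul cB cxm))
    (continuous_at_mul cf (continuous_at_add
      (continuous_at_mul (continuous_at_mul cdB c2x) cxm)
      (continuous_at_mul cB cE))).
Qed.

Let cdY i : continuous (dY i).
Proof.
have h1 := continuous_inner_mul (smooth_continuous (smooth_partial i sf))
  (inner_support_partial i kf) (@cQ i).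
have h2 := continuous_inner_mul (smooth_continuous sf) kf (@cdQ i).
by move=> x; exact: continuous_at_add (h1 x) (h2 x).
Qed.

Let sum_dY x : sqn x < 1 -> \sum_i dY i x =
  al * (A x * grad_sqr f x + f x * (2 * dA x * euler f x + A x * laplacian f x))
  + ka * (2 * f x * B x * mrad (sqn x) * euler f x
      + f x ^+ 2 * (2 * sqn x * mrad (sqn x) * dB x
          + B x * ((n%:R - 1) * mrad (sqn x) + 2 * vrad (sqn x)))).
Proof.
move=> x1.
have E i : dY i x = al * A x * partial i f x ^+ 2
  + (al * f x * (2 * dA x) + ka * (2 * f x * B x * mrad (sqn x)))
      * (x ord0 i * partial i f x)
  + al * f x * A x * partial i (partial i f) x
  + ka * f x ^+ 2 * (2 * mrad (sqn x) * dB x) * (x ord0 i * x ord0 i)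
  + ka * f x ^+ 2 * B x * coord_mrad_deriv i x.
  by rewrite /dY /Q /dQ; ring.
rewrite (eq_bigr _ (fun i _ => E i)) !big_split /= -!mulr_sumr.
rewrite sum_coord_mrad_deriv// -/(grad_sqr f x) -/(euler f x).
rewrite -/(laplacian f x) -/(dotp x x) -/(sqn x).
by ring.
Qed.

(** Common engine of the Rellich and Hardy steps: the added bracket is the divergence of [Y], and
    [al], [ka] stay free to be matched to the squares being completed. *)
Lemma radial_compare (F G : 'rV[R]_n -> R) :
  continuous F -> inner_support F -> continuous G -> inner_support G ->
  (forall x, sqn x < 1 -> G x +
    (al * (A x * grad_sqr f x + f x * (2 * dA x * euler f x + A x * laplacian f x))
    + ka * (2 * f x * B x * mrad (sqn x) * euler f x
      + f x ^+ 2 * (2 * sqn x * mrad (sqn x) * dB x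
          + B x * ((n%:R - 1) * mrad (sqn x) + 2 * vrad (sqn x))))) <= F x) ->
  (integral_dx G <= integral_dx F)%E.
Proof.
move=> cF sF cG sG h.
apply: (@le_integral_dx_divergence R n F G Y dY) => //.
- by move=> i; exact: inner_supportMl.
- move=> i; apply: inner_supportD; last exact: inner_supportMl.
  by apply: inner_supportMl; exact: inner_support_partial.
- by move=> x x1; rewrite sum_dY//; exact: h.
Qed.

End radial_compare.
End radial_on_ball.

(** * Single Rellich and Hardy steps for a fixed [d] *)

Section regularised_inequalities.
Context {R : realType} {n : nat}.
Hypothesis n3 : (3 <= n)%N.
Implicit Types (f g : 'rV[R]_n -> R) (x : 'rV[R]_n).
Local Notation N := (n%:R : R).

Let N3 : 3 <= N. Proof. by rewrite ler_nat. Qed.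
Let Nk : (n - 2)%N%:R = N - 2. Proof. by rewrite natrB// ltnW. Qed.

(* This is rho coth rho - 1, because |x| = tanh (rho / 2). *)
Definition coth_excess x : R := mrad (sqn x) * (1 + sqn x) / 2 - 1.

Lemma coth_excess_ge x : sqn x < 1 -> sqn x <= coth_excess x.
Proof.
move=> x1; have := mrad_ge2 x1; have := sqn_ge0 x.
by rewrite /coth_excess; nra.
Qed.

Lemma volume_density x : (2 / (1 - enorm x ^+ 2)) ^+ n = (2 * vrad (sqn x)) ^+ n.
Proof. by rewrite sqr_enorm. Qed.

Lemma volume_densityE x :
  (2 * vrad (sqn x)) ^+ n = 4 * wrad (n - 2) (sqn x) * vrad (sqn x) ^+ 2.
Proof.
have -> (y : R) : y ^+ n = y ^+ (n - 2) * y ^+ 2 by rewrite -exprD subnK// ltnW.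
by rewrite /wrad; ring.
Qed.

Lemma laplace_beltramiE f x : sqn x < 1 -> laplace_beltrami f x =
  laplacian f x / (4 * vrad (sqn x) ^+ 2)
    + (N - 2) / (2 * vrad (sqn x)) * euler f x.
Proof.
move=> x1; rewrite /laplace_beltrami sqr_enorm.
have -> : dotp x (grad f x) = euler f x.
  by apply: eq_bigr => i _; rewrite mxE.
have vn : 1 - sqn x != 0 by apply: lt0r_neq0; lra.
by rewrite /vrad; field.
Qed.

Lemma sqr_hyp_grad_norm f x : sqn x < 1 ->
  hyp_grad_norm f x ^+ 2 = grad_sqr f x / (4 * vrad (sqn x) ^+ 2).
Proof.
move=> x1; rewrite /hyp_grad_norm exprMn !sqr_enorm.
have -> : sqn (grad f x) = grad_sqr f x.
  by apply: eq_bigr => i _; rewrite mxE expr2.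
have vn : 1 - sqn x != 0 by apply: lt0r_neq0; lra.
by rewrite /vrad; field.
Qed.

Lemma sqn_vrad x : sqn x < 1 -> sqn x = 1 - (vrad (sqn x))^-1.
Proof. by move=> x1; rewrite /vrad invrK opprB addrC subrK. Qed.

Definition inner_continuous g := continuous g /\ inner_support g.

Lemma inner_continuousM g (P : 'rV[R]_n -> R) : inner_continuous g ->
  (forall x, sqn x < 1 -> {for x, continuous P}) ->
  inner_continuous (fun x => g x * P x).
Proof.
move=> [cg kg] cP; split; last exact: inner_supportMl.
exact: continuous_inner_mul.
Qed.

Lemma inner_continuousD g1 g2 : inner_continuous g1 -> inner_continuous g2 ->
  inner_continuous (fun x => g1 x + g2 x).
Proof.
move=> [c1 k1] [c2 k2]; split; last exact: inner_supportD.
by move=> x; exact: continuous_at_add (c1 x) (c2 x).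
Qed.

Lemma inner_smooth_continuous f : inner_smooth f -> inner_continuous f.
Proof. by move=> [sf kf]; split => //; exact: smooth_continuous. Qed.

Lemma inner_continuous_sqr g : inner_continuous g ->
  inner_continuous (fun x => g x ^+ 2).
Proof.
move=> ig; rewrite (_ : (fun x => g x ^+ 2) = (fun x => g x * g x)); last first.
  by apply/funext => x; rewrite expr2.
by apply: (inner_continuousM ig) => x _; case: ig => c _; exact: c.
Qed.

Lemma integral_dx_scale (c : R) g : inner_continuous g ->
  integral_dx (fun x => c * g x) = (c%:E * integral_dx g)%E.
Proof.
move=> [cg kg]; rewrite /integral_dx.
under eq_integral do rewrite EFinM.
exact: (integralZl measurable_ball_tuple
  (inner_support_integrable cg kg measurable_ball_tuple)).
Qed.

Lemma volume_density_continuous x : sqn x < 1 ->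
  {for x, continuous (fun y : 'rV[R]_n => (2 / (1 - enorm y ^+ 2)) ^+ n)}.
Proof.
move=> x1.
rewrite (_ : (fun y : 'rV[R]_n => (2 / (1 - enorm y ^+ 2)) ^+ n)
   = (fun y => (2 * vrad (sqn y)) ^+ n)); last first.
  by apply/funext => y; rewrite volume_density.
apply: continuous_at_exp; apply: continuous_at_mul.
  exact: continuous_at_cst.
by apply: continuous_radial; apply: vrad_continuous; exact: sqn_ball.
Qed.

Lemma inner_continuous_dV g : inner_continuous g ->
  inner_continuous (fun x => g x * (2 / (1 - enorm x ^+ 2)) ^+ n).
Proof. by move=> ig; apply: inner_continuousM => // x; exact: volume_density_continuous. Qed.

Lemma integral_dV_scale (c : R) g : inner_continuous g ->
  integral_dV (fun x => c * g x) = (c%:E * integral_dV g)%E.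
Proof.
move=> ig; rewrite /integral_dV -integral_dx_scale; last exact: inner_continuous_dV.
by congr integral_dx; apply/funext => x; rewrite mulrA.
Qed.

Lemma coth_excess_continuous x : sqn x < 1 -> {for x, continuous coth_excess}.
Proof.
move=> x1; rewrite /coth_excess.
have cm : {for x, continuous (fun y : 'rV[R]_n => mrad (sqn y))}.
  by apply: continuous_radial; apply: mrad_continuous; exact: sqn_ball.
have cs : {for x, continuous (fun y : 'rV[R]_n => 1 + sqn y)}.
  by apply: continuous_at_add; [exact: continuous_at_cst|exact: sqn_continuous].
apply: continuous_at_add; last exact: continuous_at_cst.
by apply: continuous_at_mul; [exact: continuous_at_mul|exact: continuous_at_cst].
Qed.

Section fixed_regularisation.
Variable d : R.
Hypothesis d0 : 0 < d.

Lemma upow_sqn_continuous e x : sqn x < 1 ->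
  {for x, continuous (fun y : 'rV[R]_n => upow d e (sqn y))}.
Proof.
by move=> x1; apply: continuous_radial; apply: upow_continuous => //; exact: sqn_ball.
Qed.

Lemma upow_ge0 e (s : R) : 0 <= upow d e s. Proof. exact: powR_ge0. Qed.

Lemma upowS e (j : nat) s : 0 <= s ->
  upow d (e + j%:R) s = upow d e s * ureg d s ^+ j.
Proof.
move=> s0; have u0 := ureg_gt0 d0 s0.
by rewrite /upow powRD ?(lt0r_neq0 u0) ?implybT// powR_mulrn// ltW.
Qed.

Lemma rellich_regularised f (b K : R) : inner_smooth f -> -2 < b < N - 4 ->
  K = (N - 4 - b) * (N + b) / 4 ->
  (integral_dV (fun x => (K ^+ 2 * (f x ^+ 2 * upow d (- b / 2 - 2) (sqn x))
     + K * (N - 2) * (N - 1)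
        * (coth_excess x * (f x ^+ 2 * upow d (- b / 2 - 2) (sqn x))))%R)
   <= integral_dV (fun x =>
        (laplace_beltrami f x ^+ 2 * upow d (- b / 2) (sqn x))%R))%E.
Proof.
move=> hf /andP[b2 bn] KE.
have iLB : inner_smooth (laplace_beltrami f) := inner_smooth_iter 1 hf.
set e := - b / 2 - 2.
have cu e' := @upow_sqn_continuous e'.
have iF : inner_continuous (fun x => laplace_beltrami f x ^+ 2 * upow d (- b / 2) (sqn x)
    * (2 / (1 - enorm x ^+ 2)) ^+ n).
  apply: inner_continuous_dV; apply: inner_continuousM (cu _).
  exact/inner_continuous_sqr/inner_smooth_continuous.
have iG : inner_continuous (fun x => (K ^+ 2 * (f x ^+ 2 * upow d e (sqn x))
     + K * (N - 2) * (N - 1) * (coth_excess x * (f x ^+ 2 * upow d e (sqn x))))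
    * (2 / (1 - enorm x ^+ 2)) ^+ n).
  apply: inner_continuous_dV.
  have i1 : inner_continuous (fun x => f x ^+ 2 * upow d e (sqn x)).
    apply: inner_continuousM (cu _).
    exact/inner_continuous_sqr/inner_smooth_continuous.
  rewrite (_ : (fun x => _) = (fun x => (f x ^+ 2 * upow d e (sqn x)) * (K ^+ 2 + K * (N - 2) * (N - 1) * coth_excess x))).
    apply: (inner_continuousM i1) => x x1.
    apply: continuous_at_add; first exact: continuous_at_cst.
    apply: continuous_at_mul; first exact: continuous_at_cst.
    exact: coth_excess_continuous.
  by apply/funext => x; ring.
have [cF sF] := iF; have [cG sG] := iG.
rewrite /integral_dV.
(* [al] produces the cross term of [(u Delta_g f + K f)^2] together with the gradient term of the
   second square. [ka] then balances the products of [f] with its radial derivative, because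
   [2a + g = n - 2] with [g = b + 2]. *)
apply: (radial_compare (e := e) (al := - (2 * K)) (ka := - (K * (N - 2)))
  (k := (n - 2)%N) d0 hf cF sF cG sG) => x x1.
have s0 := sqn_ge0 x.
have u0 := ureg_gt0 d0 s0.
have v0 : 0 < vrad (sqn x) := vrad_gt0 x1.
have un := lt0r_neq0 u0; have vn := lt0r_neq0 v0.
have g0 : 0 < b + 2 by lra.
have gn : b + 2 < N - 2 by lra.
have w0 : 0 <= wrad (n - 2) (sqn x) by rewrite exprn_ge0// mulr_ge0// ltW.
have n2 : 2 < N by lra.
have aE : (N - 4 - b) / 2 = (N - 2 - (b + 2)) / 2 by ring.
have := rellich_pointwise (f x) (laplacian f x) n2 g0 gn aE (sqn_vrad x1) v0
  (erefl (ureg d (sqn x))) (ltW d0) u0 (upow_ge0 e (sqn x)) w0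
  (grad_euler_ge0 f x).
rewrite /= volume_density volume_densityE laplace_beltramiE//.
rewrite (_ : - b / 2 = e + 2%:R); last by rewrite /e; lra.
rewrite (upowS e 2 s0).
rewrite /Arad /dArad /Brad /dBrad /coth_excess Nk KE.
rewrite (_ : - (b + 2) / 2 = e + 1); last by rewrite /e; lra.
move=> h; rewrite -[leRHS]mulrA.
apply: le_trans h; rewrite le_eqVlt; apply/orP; left; apply/eqP.
by field.
Qed.

Lemma inner_continuous_sqr_hyp_grad f : inner_smooth f ->
  inner_continuous (fun x => hyp_grad_norm f x ^+ 2).
Proof.
move=> [sf kf].
rewrite (_ : (fun x => _) = (fun x => \sum_i
    (partial i f x * (partial i f x * ((1 - sqn x) / 2) ^+ 2)))); last first.
  apply/funext => x; rewrite /hyp_grad_norm exprMn !sqr_enorm mulrC.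
  by rewrite {1}/sqn /dotp mulr_suml; apply: eq_bigr => i _; rewrite mxE; ring.
pose g i x := partial i f x * (partial i f x * ((1 - sqn x) / 2) ^+ 2).
have ig i : inner_continuous (g i).
  have sp := smooth_continuous (smooth_partial i sf).
  apply: inner_continuousM => [|x _].
    by split => //; exact: inner_support_partial.
  apply: continuous_at_mul; first exact: sp.
  apply: continuous_at_exp; apply: continuous_at_mul; last exact: continuous_at_cst.
  apply: continuousB; first exact: continuous_at_cst.
  exact: sqn_continuous.
rewrite (_ : (fun x => _) = \sum_i g i); last first.
  by apply/funext => x; rewrite fct_sumE.
apply: (big_ind inner_continuous) => //.
- split; first by move=> x; exact: continuous_at_cst.
  by exists 0.
- by move=> g1 g2; exact: inner_continuousD.
Qed.

(** The resulting weight [u^(-b/2-1)] is the right-hand weight of a Rellich step with parameter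
    [b + 2], so the two inequalities chain. *)
Lemma hardy_regularised f (b a : R) : inner_smooth f -> -2 < b < N - 2 ->
  a = (N - 2 - b) / 2 ->
  (integral_dV (fun x => (a ^+ 2 * (f x ^+ 2 * upow d (- b / 2 - 1) (sqn x)))%R)
   <= integral_dV (fun x =>
        (hyp_grad_norm f x ^+ 2 * upow d (- b / 2) (sqn x))%R))%E.
Proof.
move=> hf /andP[b2 bn] aE; have [sf kf] := hf.
set e := - b / 2 - 1.
have cu e' := @upow_sqn_continuous e'.
have isf := inner_continuous_sqr (inner_smooth_continuous hf).
have [cG sG] : inner_continuous (fun x => a ^+ 2 * (f x ^+ 2 * upow d e (sqn x))
    * (2 / (1 - enorm x ^+ 2)) ^+ n).
  apply: inner_continuous_dV.
  rewrite (_ : (fun x => _) = (fun x => f x ^+ 2 * (a ^+ 2 * upow d e (sqn x)))).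
    apply: (inner_continuousM isf) => x x1.
    by apply: continuous_at_mul; [exact: continuous_at_cst|exact: cu].
  by apply/funext => x; ring.
have [cF sF] : inner_continuous (fun x =>
    hyp_grad_norm f x ^+ 2 * upow d (- b / 2) (sqn x)
    * (2 / (1 - enorm x ^+ 2)) ^+ n).
  apply: inner_continuous_dV; apply: inner_continuousM (cu _).
  exact: inner_continuous_sqr_hyp_grad.
rewrite /integral_dV.
(* The square is already of first order, so no field involving [grad f] is needed; [ka = -a]
   balances its cross term. *)
apply: (radial_compare (e := e) (al := 0) (ka := - a)
  (k := (n - 2)%N) d0 hf cF sF cG sG) => x x1.
have s0 := sqn_ge0 x.
have u0 := ureg_gt0 d0 s0.
have v0 : 0 < vrad (sqn x) := vrad_gt0 x1.
have un := lt0r_neq0 u0; have vn := lt0r_neq0 v0.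
have w0 : 0 <= wrad (n - 2) (sqn x) by rewrite exprn_ge0// mulr_ge0// ltW.
have n1 : 1 <= N by rewrite ler1n (leq_trans _ n3).
have H0 : 0 <= mrad (sqn x) * (1 + sqn x) / 2 - 1.
  exact: le_trans s0 (coth_excess_ge x1).
have := hardy_pointwise (f x) b2 bn aE (sqn_vrad x1) v0
  (erefl (ureg d (sqn x))) (ltW d0) u0 (upow_ge0 e (sqn x)) w0 H0 n1
  (grad_euler_ge0 f x).
rewrite /= volume_density volume_densityE sqr_hyp_grad_norm//.
rewrite (_ : - b / 2 = e + 1%:R); last by rewrite /e mulr1n subrK.
rewrite (upowS e 1 s0).
rewrite /Arad /dArad /Brad /dBrad Nk.
rewrite (_ : e + 1%:R - 1 = e); last by rewrite mulr1n addrK.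
move=> h; rewrite -[leRHS]mulrA.
apply: le_trans h; rewrite le_eqVlt; apply/orP; left; apply/eqP.
by field.
Qed.


End fixed_regularisation.
End regularised_inequalities.

(** * Iteration of the regularised Rellich inequality *)

Section iterated_inequality.
Context {R : realType} {n : nat}.
Hypothesis n3 : (3 <= n)%N.
Implicit Types (f g : 'rV[R]_n -> R) (x : 'rV[R]_n).
Local Notation N := (n%:R : R).
Variable d : R.
Hypothesis d0 : 0 < d.

Lemma le_integral_dV f g : inner_continuous f -> inner_continuous g ->
  (forall x, sqn x < 1 -> f x <= g x) -> (integral_dV f <= integral_dV g)%E.
Proof.
move=> /inner_continuous_dV[cf kf] /inner_continuous_dV[cg kg] fg.
have mB := @measurable_ball_tuple R n.
apply: le_integral => //.
- exact: inner_support_integrable cf kf mB.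
- exact: inner_support_integrable cg kg mB.
move=> t; rewrite inE => /poincare_ballE x1 /=.
rewrite lee_fin ler_wpM2r ?fg// volume_density exprn_ge0//.
by rewrite mulr_ge0// ltW// vrad_gt0.
Qed.

Definition rellich_factor (b : R) : R := ((N - 4 - b) * (N + b) / 4) ^+ 2.

Lemma rellich_factor_gt0 b : -2 < b < N - 4 -> 0 < rellich_factor b.
Proof.
move=> /andP[b2 bn]; have N3 : 3 <= N by rewrite ler_nat.
by rewrite exprn_gt0// divr_gt0// mulr_gt0//; lra.
Qed.

Lemma inner_continuous_upow e g : inner_continuous g ->
  inner_continuous (fun x => g x * upow d e (sqn x)).
Proof.
by move=> ig; apply: inner_continuousM => // x; exact: upow_sqn_continuous.
Qed.

Lemma inner_continuous_coth (th : R) g : inner_continuous g ->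
  inner_continuous (fun x => (1 + th * coth_excess x) * g x).
Proof.
move=> ig.
rewrite (_ : (fun x => _) = (fun x => g x * (1 + th * coth_excess x))); last first.
  by apply/funext => x; rewrite mulrC.
apply: inner_continuousM => // x x1.
apply: continuous_at_add; first exact: continuous_at_cst.
apply: continuous_at_mul; first exact: continuous_at_cst.
exact: coth_excess_continuous.
Qed.

Lemma inner_continuousZ (c : R) g : inner_continuous g ->
  inner_continuous (fun x => c * g x).
Proof.
move=> ig; rewrite (_ : (fun x => _) = (fun x => g x * c)); last first.
  by apply/funext => x; rewrite mulrC.
by apply: inner_continuousM => // x _; exact: continuous_at_cst.
Qed.

(** Each outer step acts on an iterated Laplacian, raises [b] by 4 and gives up its remainder; the
    last one acts on [f] with parameter [b + 4(l-1)], which yields the denominator [N - 4l - b]. *)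
Lemma iterated_rellich_regularised l (b : R) f : inner_smooth f -> (0 < l)%N ->
  -2 < b -> b < N - 4 * l%:R ->
  (integral_dV (fun x => (\prod_(i < l) rellich_factor (b + 4 * i%:R) *
     ((1 + 2 * (N - 1) / (N - 4 * l%:R - b) * coth_excess x)
        * f x ^+ 2 * upow d (- b / 2 - 2 * l%:R) (sqn x)))%R)
   <= integral_dV (fun x =>
        (iter l laplace_beltrami f x ^+ 2 * upow d (- b / 2) (sqn x))%R))%E.
Proof.
move=> hf; have N3 : 3 <= N by rewrite ler_nat.
have isq g : inner_smooth g -> inner_continuous (fun x => g x ^+ 2).
  by move=> hg; exact/inner_continuous_sqr/inner_smooth_continuous.
elim: l b => // -[_|l IH] b _ b2 bl.
  rewrite mulr1 in bl; rewrite !mulr1 big_ord1 mulr0 addr0.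
  have h4 : -2 < b < N - 4 by rewrite b2.
  apply: le_trans (rellich_regularised n3 d0 hf h4 erefl).
  apply: le_integral_dV.
  - apply: inner_continuousZ.
    apply: inner_continuous_upow.
    by apply: inner_continuous_coth; exact: isq.
  - apply: inner_continuousD; apply: inner_continuousZ.
      by apply: inner_continuous_upow; exact: isq.
    have := inner_continuous_upow (- b / 2 - 2) (isq _ hf).
    move=> /inner_continuousM; rewrite (_ : (fun x => coth_excess x * _) =
      (fun x => f x ^+ 2 * upow d (- b / 2 - 2) (sqn x) * coth_excess x)).
      by apply; exact: coth_excess_continuous.
    by apply/funext => x; rewrite mulrC.
  move=> x x1.
  have := le_trans (sqn_ge0 x) (coth_excess_ge x1).
  have : 0 <= f x ^+ 2 * upow d (- b / 2 - 2) (sqn x).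
    by rewrite mulr_ge0 ?sqr_ge0 ?upow_ge0.
  rewrite -[X in _ * X <= _]mulrA.
  move: (coth_excess x) (f x ^+ 2 * _) => H q q0 H0.
  pose K := (N - 4 - b) * (N + b) / 4.
  have -> : rellich_factor b * ((1 + 2 * (N - 1) / (N - 4 - b) * H) * q) =
    K ^+ 2 * q + K * ((N - 1) * (N + b) / 2) * (H * q).
    by rewrite /rellich_factor /K; field; lra.
  rewrite -/K lerD2l.
  apply: ler_wpM2r; first exact: mulr_ge0.
  (* The available coefficient [n - 2] is weakened to [(n + b)/2], which is smaller since
     [b < n - 4]; this allows [K^2] to be factored out of both terms. *)
  rewrite -[leRHS]mulrA; apply: ler_wpM2l; last by nra.
  by rewrite divr_ge0// mulr_ge0//; lra.
have bl4 : b + 4 < N - 4 * l.+1%:R.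
  by move: bl; rewrite -[l.+2%:R]natr1; lra.
have ls : 0 <= (l.+1%:R : R) by [].
have h4 : -2 < b < N - 4 by lra.
have hg := inner_smooth_iter l.+1 hf.
rewrite [in leRHS]iterS.
apply: le_trans (rellich_regularised n3 d0 hg h4 erefl).
apply: (@le_trans _ _ (integral_dV (fun x => (rellich_factor b *
   (iter l.+1 laplace_beltrami f x ^+ 2 * upow d (- (b + 4) / 2) (sqn x)))%R))).
  rewrite [leRHS]integral_dV_scale; last exact: inner_continuous_upow _ (isq _ hg).
  have b4 : -2 < b + 4 by lra.
  have := IH (b + 4) isT b4 bl4.
  have K0 : (0 <= (rellich_factor b)%:E)%E.
    by rewrite lee_fin ltW// rellich_factor_gt0.
  move=> /(lee_wpmul2l K0); apply: le_trans.
  rewrite -integral_dV_scale; last first.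
    apply: inner_continuousZ; apply: inner_continuous_upow.
    by apply: inner_continuous_coth; exact: isq.
  rewrite le_eqVlt; apply/orP; left; apply/eqP; congr integral_dV.
  apply/funext => x; rewrite [in LHS]big_ord_recl mulr0 addr0 -[LHS]mulrA; congr (_ * (_ * _)).
    by apply: eq_bigr => i _; rewrite lift0 -natr1; congr rellich_factor; ring.
  rewrite (_ : N - 4 * l.+2%:R - b = N - 4 * l.+1%:R - (b + 4)); last first.
    by rewrite -[l.+2%:R]natr1; ring.
  rewrite (_ : - b / 2 - 2 * l.+2%:R = - (b + 4) / 2 - 2 * l.+1%:R)//.
  by rewrite -[l.+2%:R]natr1; lra.
apply: le_integral_dV.
- exact: inner_continuousZ (inner_continuous_upow _ (isq _ hg)).
- apply: inner_continuousD; apply: inner_continuousZ.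
    exact: inner_continuous_upow _ (isq _ hg).
  have := inner_continuous_upow (- b / 2 - 2) (isq _ hg).
  move=> /inner_continuousM; rewrite (_ : (fun x => coth_excess x * _) =
    (fun x => iter l.+1 laplace_beltrami f x ^+ 2 * upow d (- b / 2 - 2) (sqn x) * coth_excess x)).
    by apply; exact: coth_excess_continuous.
  by apply/funext => x; rewrite mulrC.
move=> x x1.
rewrite (_ : - (b + 4) / 2 = - b / 2 - 2); last by lra.
(* The remainder of an outer step is nonnegative and is dropped here. *)
rewrite lerDl mulr_ge0//.
  by rewrite !mulr_ge0//; lra.
apply: mulr_ge0; first exact: le_trans (sqn_ge0 x) (coth_excess_ge x1).
by apply: mulr_ge0; [exact: sqr_ge0|exact: upow_ge0].
Qed.

End iterated_inequality.

(** * The limit as [d] tends to 0 *)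

Section removing_regularisation.
Context {R : realType} {n : nat}.
Hypothesis n3 : (3 <= n)%N.
Implicit Types (S T : 'rV[R]_n -> R) (x : 'rV[R]_n) (t : n.-tuple R).
Local Notation mu := (lebesgue_tuple R n).
Local Notation B := (@ball_tuple R n).

Lemma rhoE x : rho x = enorm x * mrad (sqn x).
Proof.
rewrite /rho -/(artanh2 _) /mrad; case: ltP => s0.
  rewrite [RHS]mulrC mulfVK//.
  by rewrite lt0r_neq0// sqrtr_gt0.
have e0 : enorm x = 0 by apply/eqP; rewrite sqrtr_eq0.
by rewrite e0 artanh2_0 mul0r.
Qed.

Lemma sqr_rho x : rho x ^+ 2 = sqn x * mrad (sqn x) ^+ 2.
Proof. by rewrite rhoE exprMn sqr_enorm. Qed.

Lemma rho_ge0 x : sqn x < 1 -> 0 <= rho x.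
Proof.
move=> x1; rewrite rhoE mulr_ge0 ?enorm_ge0//.
by apply: le_trans (mrad_ge2 x1).
Qed.

Lemma rho_gt0 x : sqn x < 1 -> sqn x != 0 -> 0 < rho x.
Proof.
move=> x1 x0; rewrite lt_neqAle rho_ge0// andbT eq_sym -sqrf_eq0 sqr_rho.
rewrite mulf_neq0// expf_neq0// lt0r_neq0//.
by apply: lt_le_trans (mrad_ge2 x1).
Qed.

Lemma upow_rho d e x : upow d e (sqn x) = (rho x ^+ 2 + d) `^ e.
Proof. by rewrite /upow /ureg sqr_rho. Qed.

Lemma volume_density_ge0 x : sqn x < 1 -> 0 <= (2 / (1 - enorm x ^+ 2)) ^+ n.
Proof.
by move=> x1; rewrite volume_density exprn_ge0// mulr_ge0// ltW// vrad_gt0.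
Qed.

Lemma measurable_rho : measurable_fun B (fun t => rho (tuple_row t)).
Proof.
have me : measurable_fun [set: n.-tuple R] (fun t => enorm (tuple_row t)).
  apply: (measurable_tuple_row_continuous (F := @enorm R n)) => x.
  by apply: continuous_comp; [exact: sqn_continuous|exact: sqrt_continuous].
apply: (eq_measurable_fun (fun t => ln (1 + enorm (tuple_row t)) - ln (1 - enorm (tuple_row t)))).
  move=> t; rewrite inE => tB.
  have e0 := enorm_ge0 (tuple_row t).
  have e1 : enorm (tuple_row t) < 1 by exact: tB.
  by rewrite /rho ln_div// posrE; lra.
apply: measurable_funTS; apply: measurable_funB.
- apply: measurableT_comp; first exact: measurable_ln.
  by apply: measurable_funD => //; exact: measurable_cst.
- apply: measurableT_comp; first exact: measurable_ln.
  by apply: measurable_funB => //; exact: measurable_cst.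
Qed.

Lemma measurable_div_rho S e : continuous S ->
  measurable_fun B (fun t => S (tuple_row t) / rho (tuple_row t) `^ e).
Proof.
move=> cS.
rewrite (_ : (fun t => _) = (fun t => S (tuple_row t) * rho (tuple_row t) `^ (- e))); last first.
  by apply/funext => t; rewrite powRN.
apply: measurable_funM.
  by apply: measurable_funTS; exact: measurable_tuple_row_continuous.
apply: (@measurableT_comp _ _ _ _ _ _ (fun r : R => r `^ (- e))); last exact: measurable_rho.
exact: measurable_powR.
Qed.

Lemma measurable_volume_density :
  measurable_fun B (fun t => (2 / (1 - enorm (tuple_row t) ^+ 2)) ^+ n : R).
Proof.
have ms : measurable_fun [set: n.-tuple R] (fun t => 1 - sqn (tuple_row t)).
  apply: (measurable_tuple_row_continuous (F := fun x : 'rV[R]_n => 1 - sqn x)) => x.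
  by apply: continuousB; [exact: cst_continuous|exact: sqn_continuous].
apply: (eq_measurable_fun (fun t => (2 * (1 - sqn (tuple_row t)) `^ (-1)) ^+ n)).
  move=> t; rewrite inE => /poincare_ballE t1.
  by rewrite powR_inv1 ?sqr_enorm// subr_ge0 ltW.
apply: measurable_funTS; apply: measurable_funX; apply: measurable_funM.
  exact: measurable_cst.
by apply: (@measurableT_comp _ _ _ _ _ _ (fun r : R => r `^ (- 1))) => //; exact: measurable_powR.
Qed.

Definition origin : set (n.-tuple R) := [set t | sqn (tuple_row t) = 0].

Lemma measurable_origin : measurable origin.
Proof.
have := @measurable_tuple_row_continuous R n sqn sqn_continuous.
move=> /(_ measurableT [set 0] (measurable_set1 _)).
by rewrite setTI.
Qed.

(** The origin lies in the hyperplane where the first coordinate is 0, which is null; a first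
    coordinate exists because [n] is positive. *)
Lemma lebesgue_tuple_origin : mu origin = 0%E.
Proof.
have mO := measurable_origin; move: mO; rewrite /origin.
case: n n3 => // m _ mO.
apply/eqP; rewrite eq_le measure_ge0 andbT.
have -> : lebesgue_tuple R m.+1 [set t | sqn (tuple_row t) = 0] =
  (@ltup R m \x (@lebesgue_measure R))%E
    (@cons_pair R m @^-1` [set t | sqn (tuple_row t) = 0]) by [].
apply: (@le_trans _ _ ((@ltup R m \x (@lebesgue_measure R))%E (setT `*` [set 0]))).
  apply: le_measure; rewrite ?inE.
  - by rewrite -[X in measurable X]setTI; exact: measurable_cons_pairR.
  - by apply: measurableX => //; exact: measurable_set1.
  - move=> [u y] /= /sqn_eq0 h; split => //.
    by move/rowP: h => /(_ ord0); rewrite !mxE.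
rewrite product_measure1E//.
by rewrite [X in (_ * X)%E](_ : _ = 0%E) ?mule0//; exact: lebesgue_measure_set1.
Qed.

(** The origin has to be removed: division by zero returns 0 there, whereas the regularised weights
    with negative exponent tend to infinity, so pointwise limits and bounds fail at that point. *)
Lemma integral_dx_origin S :
  measurable_fun B (fun t => S (tuple_row t)) ->
  (forall x, sqn x < 1 -> 0 <= S x) ->
  integral_dx S = (\int[mu]_(t in B `\` origin) (S (tuple_row t))%:E)%E.
Proof.
move=> mS S0; apply: ge0_negligible_integral => //.
- exact: measurable_origin.
- exact: measurable_ball_tuple.
- exact/measurable_EFinP.
- by move=> t /poincare_ballE /S0; rewrite lee_fin.
- exact: lebesgue_tuple_origin.
Qed.

(** Write [(y+a)^p] as [y (y+a)^(p-1) + a (y+a)^(p-1)]; as [p - 1 <= 0], shrinking the base to [y],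
    respectively [a], only increases each term. *)
Lemma powR_add_le (p a : R) : 0 < p <= 1 ->
  forall y, 0 <= y -> 0 < a -> (y + a) `^ p <= y `^ p + a `^ p.
Proof.
move=> /andP[p0 p1] y; rewrite le_eqVlt => /predU1P[<-|y0] a0.
  by rewrite add0r lerDr powR_ge0.
have z0 : 0 < y + a by lra.
have mono w : 0 < w -> w <= y + a -> w * (y + a) `^ (p - 1) <= w `^ p.
  move=> w0 wz.
  rewrite -(mulr_powRB1 (ltW w0) p0).
  apply: ler_wpM2l; first exact: ltW.
  rewrite (_ : p - 1 = - (1 - p)); last by ring.
  rewrite !powRN lef_pV2 ?posrE ?powR_gt0//.
  by apply: ge0_ler_powR; rewrite ?nnegrE; lra.
rewrite -(mulr_powRB1 (ltW z0) p0) mulrDl.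
by apply: lerD; apply: mono => //; lra.
Qed.

Lemma powR_sqr (r e : R) : 0 <= r -> (r ^+ 2) `^ e = r `^ (2 * e).
Proof. by move=> r0; rewrite -powR_mulrn// -powRrM. Qed.

(* For b <= 0 the regularised weight is dominated by the singular one; for
   0 < b < 1 the error is controlled by subadditivity of the power. *)
Lemma upow_le_rho (b d : R) x : b <= 1 -> 0 < d -> sqn x < 1 -> sqn x != 0 ->
  upow d b (sqn x) <= (rho x `^ (- (2 * b)))^-1 + (if 0 < b then d `^ b else 0).
Proof.
move=> b1 d0 x1 x0; have r0 := rho_gt0 x1 x0.
have q0 : 0 < rho x ^+ 2 by rewrite exprn_gt0.
have q1 : 0 < rho x ^+ 2 + d by lra.
rewrite -powRN opprK -(powR_sqr _ (ltW r0)) upow_rho.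
case: ltP => b0; first by apply: powR_add_le => //; [apply/andP; split; lra|exact: ltW].
rewrite addr0 -[X in _ `^ X <= _ `^ X]opprK !(powRN _ (- b)) lef_pV2 ?posrE ?powR_gt0//.
by apply: ge0_ler_powR; rewrite ?nnegrE; lra.
Qed.

(** On the left the weights increase as [d] decreases, so monotone convergence applies. On the right
    the regularised integral exceeds the singular one by at most [d^b] times a finite integral, and
    by nothing if [b <= 0]. *)
Lemma regularised_limit (b c : R) S T : b < 1 -> 0 < c ->
  inner_continuous S -> inner_continuous T ->
  (forall x, sqn x < 1 -> 0 <= S x) -> (forall x, sqn x < 1 -> 0 <= T x) ->
  (forall d, 0 < d ->
    (integral_dV (fun x => (S x * upow d (- c) (sqn x))%R) <=
     integral_dV (fun x => (T x * upow d b (sqn x))%R))%E) ->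
  (integral_dV (fun x => (S x / rho x `^ (2 * c))%R) <=
   integral_dV (fun x => (T x / rho x `^ (- (2 * b)))%R))%E.
Proof.
move=> b1 c0 iS iT S0 T0 H.
pose W x : R := (2 / (1 - enorm x ^+ 2)) ^+ n.
pose dk (k : nat) : R := harmonic k.
have dk0 k : 0 < dk k by rewrite /dk /= invr_gt0.
pose D := B `\` origin.
have mB : measurable B := @measurable_ball_tuple R n.
have mD : measurable D by apply: measurableD => //; exact: measurable_origin.
have DB : D `<=` B by move=> t [].
have Dx t : D t -> sqn (tuple_row t) < 1 /\ sqn (tuple_row t) != 0.
  by move=> [/poincare_ballE t1 /eqP t0].
have mW := measurable_volume_density.
have mSr e U : inner_continuous U ->
    measurable_fun B (fun t => U (tuple_row t) / rho (tuple_row t) `^ e * W (tuple_row t)).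
  by move=> [cU _]; apply: measurable_funM mW; exact: measurable_div_rho.
have mc U : inner_continuous U -> measurable_fun B (fun t => U (tuple_row t)).
  by move=> [cU _]; apply: measurable_funTS; exact: measurable_tuple_row_continuous.
have iSk k : inner_continuous (fun x => S x * upow (dk k) (- c) (sqn x) * W x).
  by apply: inner_continuous_dV; exact: inner_continuous_upow.
have iTk k : inner_continuous (fun x => T x * upow (dk k) b (sqn x) * W x).
  by apply: inner_continuous_dV; exact: inner_continuous_upow.
have iTW : inner_continuous (fun x => T x * W x) by exact: inner_continuous_dV.
have W0 x : sqn x < 1 -> 0 <= W x by exact: volume_density_ge0.
rewrite /integral_dV.
rewrite integral_dx_origin; [|exact: mSr|]; last first.
  by move=> x x1; rewrite mulr_ge0 ?W0// divr_ge0 ?S0 ?powR_ge0.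
have mTr := mSr (- (2 * b)) T iT.
have T0W x : sqn x < 1 -> 0 <= T x / rho x `^ (- (2 * b)) * W x.
  by move=> x1; rewrite mulr_ge0 ?W0// divr_ge0 ?T0 ?powR_ge0.
rewrite integral_dx_origin//.
set I := (X in (_ <= X)%E).
pose rk k : R := if 0 < b then dk k `^ b else 0.
have rk0 k : 0 <= rk k by rewrite /rk; case: ifP => // _; exact: powR_ge0.
pose M := (\int[mu]_(t in D) (T (tuple_row t) * W (tuple_row t))%:E)%E.
have Mfin : M \is a fin_num.
  apply: integrable_fin_num => //.
  exact: (inner_support_integrable iTW.1 iTW.2 mD).
pose g (k : nat) t : \bar R :=
  (S (tuple_row t) * upow (dk k) (- c) (sqn (tuple_row t)) * W (tuple_row t))%:E.
have gle k : (\int[mu]_(t in D) g k t <= I + (rk k)%:E * M)%E.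
  rewrite -[leLHS](integral_dx_origin (S := fun x => S x * upow (dk k) (- c) (sqn x) * W x)); first last.
  - by move=> x x1; rewrite mulr_ge0 ?W0// mulr_ge0 ?S0 ?upow_ge0.
  - exact: mc (iSk k).
  apply: le_trans (H (dk k) (dk0 k)) _.
  rewrite /integral_dV integral_dx_origin; first last.
  - by move=> x x1; rewrite mulr_ge0 ?W0// mulr_ge0 ?T0 ?upow_ge0.
  - exact: mc (iTk k).
  rewrite /M -ge0_integralZl_EFin//; first last.
  - by apply/measurable_EFinP; apply: measurable_funS (mc _ iTW).
  - by move=> t /Dx[t1 _]; rewrite lee_fin mulr_ge0 ?T0 ?W0.
  rewrite /I -ge0_integralD//; first last.
  - by apply/measurable_EFinP; apply: measurable_funM; [exact: measurable_cst|apply: measurable_funS (mc _ iTW)].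
  - by move=> t /Dx[t1 _]; rewrite lee_fin mulr_ge0// mulr_ge0 ?T0 ?W0.
  - by apply/measurable_EFinP; apply: measurable_funS mTr.
  - by move=> t /Dx[t1 _]; rewrite lee_fin T0W.
  apply: ge0_le_integral => //.
  - by move=> t /Dx[t1 _]; rewrite lee_fin mulr_ge0 ?W0// mulr_ge0 ?T0 ?upow_ge0.
  - by apply/measurable_EFinP; apply: measurable_funS (mc _ (iTk k)).
  - apply/measurable_EFinP; apply: measurable_funD; first by apply: measurable_funS mTr.
    by apply: measurable_funM; [exact: measurable_cst|apply: measurable_funS (mc _ iTW)].
  move=> t /Dx[t1 t0]; rewrite -EFinM -EFinD lee_fin.
  apply: (@le_trans _ _ (T (tuple_row t) *
    ((rho (tuple_row t) `^ (- (2 * b)))^-1 + rk k) * W (tuple_row t))); last first.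
    rewrite le_eqVlt; apply/orP; left; apply/eqP.
    by rewrite /= -/(W _) mulrDr mulrDl (mulrC (rk k)) (mulrAC (T _) (rk k)) -!mulrA.
  apply: ler_wpM2r; first exact: W0.
  apply: ler_wpM2l; first exact: T0.
  exact: upow_le_rho (ltW b1) (dk0 k) t1 t0.
have dk_cvg : dk k @[k --> \oo] --> (0 : R) by exact: cvg_harmonic.
have rk_cvg : rk k @[k --> \oo] --> (0 : R).
  rewrite /rk; case: ltP => b0; last exact: cvg_cst.
  have /cvg_at_rightP := powR_cvg0 b0.
  by apply; split.
have gnd t : D t -> {homo g ^~ t : k1 k2 / (k1 <= k2)%N >-> (k1 <= k2)%E}.
  move=> /Dx[t1 t0] k1 k2 k12; rewrite lee_fin.
  apply: ler_wpM2r; first exact: W0.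
  apply: ler_wpM2l; first exact: S0.
  rewrite /upow !powRN lef_pV2 ?posrE ?powR_gt0 ?ureg_gt0 ?sqn_ge0//.
  apply: ge0_ler_powR; rewrite ?nnegrE; first exact: ltW.
  - by rewrite ltW// ureg_gt0 ?sqn_ge0.
  - by rewrite ltW// ureg_gt0 ?sqn_ge0.
  rewrite lerD2l /dk /= lef_pV2 ?posrE// ler_nat ltnS.
  exact: k12.
have mg k : measurable_fun D (g k).
  by apply/measurable_EFinP; apply: measurable_funS (mc _ (iSk k)).
have g0 k t : D t -> (0 <= g k t)%E.
  by move=> /Dx[t1 _]; rewrite lee_fin mulr_ge0 ?W0// mulr_ge0 ?S0 ?upow_ge0.
have glim : (\int[mu]_(t in D)
     (S (tuple_row t) / rho (tuple_row t) `^ (2 * c) * W (tuple_row t))%:E =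
   \int[mu]_(t in D) (fun t => limn (g ^~ t)) t)%E.
  apply: eq_integral => t; rewrite inE => /Dx[t1 t0]; apply/esym.
  have r0 := rho_gt0 t1 t0.
  have q0 : 0 < rho (tuple_row t) ^+ 2 by rewrite exprn_gt0.
  have up : upow (dk k) (- c) (sqn (tuple_row t)) @[k --> \oo] -->
      (rho (tuple_row t) `^ (2 * c))^-1.
    rewrite -powRN (_ : - (2 * c) = 2 * - c); last by ring.
    rewrite -(powR_sqr _ (ltW r0)).
    under eq_fun do rewrite upow_rho.
    have cp := is_derive1_continuous_at (is_derive1_powR (- c) q0).
    have dc : (rho (tuple_row t) ^+ 2 + dk k) @[k --> \oo] --> rho (tuple_row t) ^+ 2.
      rewrite -[X in _ --> X]addr0.
      by apply: cvgD; [exact: cvg_cst|exact: dk_cvg].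
    exact: cvg_comp dc cp.
  apply: cvg_lim => //; apply: cvg_EFin; first by near=> k.
  exact: cvgM (cvgM (cvg_cst (S (tuple_row t))) up) (cvg_cst (W (tuple_row t))).
have gcvg : (\int[mu]_(t in D) g k t)%E @[k --> \oo] --> (\int[mu]_(t in D)
     (S (tuple_row t) / rho (tuple_row t) `^ (2 * c) * W (tuple_row t))%:E)%E.
  rewrite glim.
  have G := cvg_monotone_convergence (mu := mu) mD mg g0 gnd; exact: G.
(* The singular integral on the right may diverge, and then the claim is trivial; otherwise the
   limit is taken among finite numbers. *)
have [Ioo|Ioo] := eqVneq I +oo%E; first by rewrite Ioo leey.
have I0 : (0 <= I)%E.
  by apply: integral_ge0 => t /Dx[t1 _]; rewrite lee_fin T0W.
have Ifin : I \is a fin_num by rewrite ge0_fin_numE// ltey.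
have bcvg : (I + (rk k)%:E * M)%E @[k --> \oo] --> I.
  rewrite -(fineK Ifin) -(fineK Mfin).
  apply: cvg_EFin; first by near=> k.
  have := cvgD (cvg_cst (fine I)) (cvgM rk_cvg (cvg_cst (fine M))).
  by rewrite mul0r addr0; apply.
apply: (lee_cvg_to gcvg bcvg).
by near=> k; exact: gle.
Unshelve. all: by end_near. Qed.


End removing_regularisation.

(** * The Lebesgue remainder, the even and odd cases, and the theorem *)

Section conclusion.
Context {R : realType} {n : nat}.
Hypothesis n3 : (3 <= n)%N.
Implicit Types (f : 'rV[R]_n -> R) (x : 'rV[R]_n).
Local Notation N := (n%:R : R).

(** With [rho^2 = s m^2], two bounds are multiplied: [s <= coth_excess], which follows from
    [m >= 2], and [2 m^2 <= 2 (2v)^2 <= (2v)^3 <= (2v)^n], which uses [m <= 2v], [v >= 1] and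
    [n >= 3]. *)
Lemma coth_excess_volume x : sqn x < 1 ->
  2 * rho x ^+ 2 <= coth_excess x * (2 / (1 - enorm x ^+ 2)) ^+ n.
Proof.
move=> x1; have s0 := sqn_ge0 x.
have m2 := mrad_ge2 x1.
have m1 : mrad (sqn x) <= 2 * vrad (sqn x) by apply: mrad_le; rewrite s0.
have H0 := coth_excess_ge x1.
have v1 : 1 <= vrad (sqn x) by lra.
rewrite volume_density sqr_rho.
have W1 : 2 * (2 * vrad (sqn x)) ^+ 2 <= (2 * vrad (sqn x)) ^+ n.
  apply: (@le_trans _ _ ((2 * vrad (sqn x)) ^+ 3)).
    by rewrite [leRHS]exprS ler_wpM2r ?sqr_ge0//; lra.
  by apply: ler_weXn2l => //; lra.
have W2 : 2 * mrad (sqn x) ^+ 2 <= (2 * vrad (sqn x)) ^+ n.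
  by apply: le_trans W1; rewrite ler_wpM2l// lerXn2r ?nnegrE//; lra.
rewrite mulrCA; apply: ler_pM => //.
by rewrite mulr_ge0 ?sqr_ge0.
Qed.

(** The excess absorbs the volume density and gains [2 rho^2]: this lowers the exponent of [rho] by
    2, replaces [dV_g] by [dx] and doubles the coefficient. *)
Lemma split_coth_excess (c P th : R) f : inner_continuous f ->
  0 <= P -> 0 <= th -> 1 < c ->
  (P%:E * integral_dV (fun x => (f x ^+ 2 / rho x `^ (2 * c))%R)
   + (2 * P * th)%:E * integral_dx (fun x => (f x ^+ 2 / rho x `^ (2 * c - 2))%R)
   <= integral_dV (fun x =>
        (P * ((1 + th * coth_excess x) * f x ^+ 2) / rho x `^ (2 * c))%R))%E.
Proof.
move=> hf P0 th0 c1.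
have mB := @measurable_ball_tuple R n.
have if2 := inner_continuous_sqr hf.
have iS : inner_continuous (fun x => P * ((1 + th * coth_excess x) * f x ^+ 2)).
  exact: inner_continuousZ (inner_continuous_coth th if2).
have mW := @measurable_volume_density R n.
have m1 : measurable_fun (@ball_tuple R n) (fun t => f (tuple_row t) ^+ 2
    / rho (tuple_row t) `^ (2 * c) * (2 / (1 - enorm (tuple_row t) ^+ 2)) ^+ n).
  by apply: measurable_funM mW; apply: (measurable_div_rho (S := fun x => f x ^+ 2)); case: if2.
have m2 : measurable_fun (@ball_tuple R n) (fun t => f (tuple_row t) ^+ 2
    / rho (tuple_row t) `^ (2 * c - 2)).
  by apply: (measurable_div_rho (S := fun x => f x ^+ 2)); case: if2.
have m3 : measurable_fun (@ball_tuple R n) (fun t =>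
    P * ((1 + th * coth_excess (tuple_row t)) * f (tuple_row t) ^+ 2)
    / rho (tuple_row t) `^ (2 * c) * (2 / (1 - enorm (tuple_row t) ^+ 2)) ^+ n).
  apply: measurable_funM mW.
  by apply: (measurable_div_rho (S := fun x => P * ((1 + th * coth_excess x) * f x ^+ 2))); case: iS.
have p1 x : sqn x < 1 -> 0 <= f x ^+ 2 / rho x `^ (2 * c) * (2 / (1 - enorm x ^+ 2)) ^+ n.
  by move=> x1; rewrite mulr_ge0 ?volume_density_ge0// divr_ge0 ?sqr_ge0 ?powR_ge0.
have p2 x : 0 <= f x ^+ 2 / rho x `^ (2 * c - 2).
  by rewrite divr_ge0 ?sqr_ge0 ?powR_ge0.
have Pth : 0 <= 2 * P * th by rewrite !mulr_ge0.
rewrite /integral_dV /integral_dx.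
rewrite -ge0_integralZl_EFin//; first last.
- exact/measurable_EFinP.
- by move=> t /poincare_ballE t1; rewrite lee_fin p1.
rewrite -ge0_integralZl_EFin//; first last.
- exact/measurable_EFinP.
- by move=> t _; rewrite lee_fin.
rewrite -ge0_integralD//; first last.
- by apply/measurable_EFinP; apply: measurable_funM => //; exact: measurable_cst.
- by move=> t _; rewrite lee_fin mulr_ge0.
- by apply/measurable_EFinP; apply: measurable_funM => //; exact: measurable_cst.
- by move=> t /poincare_ballE t1; rewrite lee_fin mulr_ge0// p1.
apply: ge0_le_integral => //.
- by move=> t /poincare_ballE t1; rewrite lee_fin addr_ge0// mulr_ge0// p1.
- apply/measurable_EFinP; apply: measurable_funD; apply: measurable_funM => //;
    exact: measurable_cst.
- exact/measurable_EFinP.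
move=> t /poincare_ballE; rewrite -/(tuple_row t); move: (tuple_row t) => x x1.
rewrite -!EFinM -EFinD lee_fin.
(* At the origin both sides are 0 by convention, because [c > 1] makes the two exponents nonzero. *)
have [s0|s0] := eqVneq (sqn x) 0.
  have -> : rho x = 0 by apply/eqP; rewrite -sqrf_eq0 sqr_rho s0 mul0r.
  rewrite !powR0 ?invr0 ?mulr0 ?mul0r ?mulr0 ?addr0//; apply: lt0r_neq0; lra.
have r0 := rho_gt0 x1 s0.
have HW := coth_excess_volume x1.
rewrite (powRB (x := rho x) (r := 2 * c) (s := 2)) ?(lt0r_neq0 r0) ?implybT//.
rewrite (powR_mulrn 2 (ltW r0)) invf_div.
have pi0 : 0 <= (rho x `^ (2 * c))^-1 by rewrite invr_ge0 powR_ge0.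
move: HW (sqr_ge0 (f x)) pi0.
move: (f x ^+ 2) (rho x ^+ 2) ((_ `^ _)^-1) (_ ^+ n) (coth_excess x) => F q p W H HW F0 p0.
rewrite -subr_ge0 (_ : _ - _ = P * th * F * p * (H * W - 2 * q)); last by ring.
by apply: mulr_ge0; [do 3!apply: mulr_ge0 => //|rewrite subr_ge0].
Qed.

(** For [p = 2] the i-th factor of the constant is [1/K] for the parameter [b + 4i], and the outer
    power [p] accounts for the square [K^2] in each Rellich step. *)
Lemma rellich_const_inv l (b : R) :
  1 / rellich_const n l b 2 = \prod_(i < l) rellich_factor (n := n) (b + 4 * i%:R).
Proof.
rewrite /rellich_const div1r -exprVn -prodfV -prodrXl.
apply: eq_bigr => i _; rewrite /rellich_factor invf_div.
congr ((_ / _) ^+ 2); last by ring.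
by congr (_ * _); ring.
Qed.

Lemma prod_rellich_factor_gt0 l (b : R) : -2 < b -> b < N - 4 * l%:R ->
  0 < \prod_(i < l) rellich_factor (n := n) (b + 4 * i%:R).
Proof.
move=> b2 bl; apply: prodr_gt0 => i _; apply: rellich_factor_gt0 => //.
have i0 : 0 <= (i%:R : R) by [].
have : (i.+1%:R : R) <= l%:R by rewrite ler_nat.
by rewrite -natr1 => il; apply/andP; split; lra.
Qed.

Lemma rellich_even l (b : R) f : inner_smooth f -> (0 < l)%N ->
  -2 < b -> b < N - 4 * l%:R ->
  ((1 / rellich_const n l b 2)%:E *
     integral_dV (fun x => (f x ^+ 2 / rho x `^ (b + 4 * l%:R))%R)
   + (4 * (N - 1) / ((N - 4 * l%:R - b) * rellich_const n l b 2))%:E *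
     integral_dx (fun x => (f x ^+ 2 / rho x `^ (4 * l%:R + b - 2))%R)
   <= integral_dV (fun x =>
        (iter l laplace_beltrami f x ^+ 2 / rho x `^ b)%R))%E.
Proof.
move=> hf l0 b2 bl; have N3 : 3 <= N by rewrite ler_nat.
have l1 : 1 <= (l%:R : R) by rewrite ler1n.
have P0 := ltW (prod_rellich_factor_gt0 b2 bl).
set P := \prod_(i < l) _ in P0.
set th := 2 * (N - 1) / (N - 4 * l%:R - b).
have th0 : 0 <= th by rewrite divr_ge0 ?mulr_ge0//; lra.
have c1 : 1 < b / 2 + 2 * l%:R by lra.
have if2 := inner_continuous_sqr (inner_smooth_continuous hf).
have := split_coth_excess (inner_smooth_continuous hf) P0 th0 c1.
rewrite (_ : 2 * (b / 2 + 2 * l%:R) = b + 4 * l%:R); last by field.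
rewrite (_ : b + 4 * l%:R - 2 = 4 * l%:R + b - 2); last by ring.
rewrite rellich_const_inv -/P.
rewrite (_ : 4 * (N - 1) / ((N - 4 * l%:R - b) * rellich_const n l b 2) = 2 * P * th); last first.
  by rewrite /P -rellich_const_inv /th invfM div1r; ring.
move=> h; apply: le_trans h _.
have ig := inner_continuous_sqr (inner_smooth_continuous (inner_smooth_iter l hf)).
have H0 x : sqn x < 1 -> 0 <= P * ((1 + th * coth_excess x) * f x ^+ 2).
  move=> x1; have := le_trans (sqn_ge0 x) (coth_excess_ge x1) => Hx.
  by apply: mulr_ge0 => //; apply: mulr_ge0; [rewrite addr_ge0// mulr_ge0|exact: sqr_ge0].
(* Here [b > -2] allows the limit: a weight [rho^(-b)] with [b < 0] is a power of [rho^2] with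
   exponent below 1. *)
have b1 : - b / 2 < 1 by lra.
have := @regularised_limit R n n3 (- b / 2) (b / 2 + 2 * l%:R) _ _ b1 (lt_trans ltr01 c1)
  (inner_continuousZ P (inner_continuous_coth th if2)) ig H0 (fun x _ => sqr_ge0 _).
rewrite (_ : 2 * (b / 2 + 2 * l%:R) = b + 4 * l%:R); last by field.
rewrite (_ : - (2 * (- b / 2)) = b); last by field.
apply => d d0; have := iterated_rellich_regularised n3 d0 hf l0 b2 bl.
rewrite (_ : - (b / 2 + 2 * l%:R) = - b / 2 - 2 * l%:R); last by ring.
apply: le_trans; rewrite le_eqVlt; apply/orP; left; apply/eqP.
by congr integral_dV; apply/funext => x; rewrite -!mulrA.
Qed.

(** A Hardy step with parameter [b] on the iterated Laplacian, then the iterated Rellich inequality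
    with parameter [2 + b], both for the same [d]. Their constants multiply to [a^2 P], by which the
    result is finally divided. *)
Lemma rellich_odd l (b : R) f : inner_smooth f -> (0 < l)%N ->
  -2 < b -> b < N - 2 * (2 * l%:R + 1) ->
  (integral_dV (fun x => (f x ^+ 2 / rho x `^ (b + 2 * (2 * l%:R + 1)))%R)
   + (4 * (N - 1) / (N - 2 * (2 * l%:R + 1) - b))%:E *
     integral_dx (fun x => (f x ^+ 2 / rho x `^ (b + 4 * l%:R))%R)
   <= (4 / (N - 2 - b) ^+ 2 * rellich_const n l (2 + b) 2)%:E *
     integral_dV (fun x =>
        (hyp_grad_norm (iter l laplace_beltrami f) x ^+ 2 / rho x `^ b)%R))%E.
Proof.
move=> hf l0 b2 bl; have N3 : 3 <= N by rewrite ler_nat.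
have l1 : 1 <= (l%:R : R) by rewrite ler1n.
have b2' : -2 < 2 + b by lra.
have bl' : 2 + b < N - 4 * l%:R by lra.
have P0 := prod_rellich_factor_gt0 b2' bl'.
set P := \prod_(i < l) _ in P0.
set a := (N - 2 - b) / 2.
have a0 : 0 < a by rewrite /a; lra.
have a2P : 0 < a ^+ 2 * P by rewrite mulr_gt0// exprn_gt0.
set th := 2 * (N - 1) / (N - 4 * l%:R - (2 + b)).
have th0 : 0 <= th by rewrite divr_ge0 ?mulr_ge0//; lra.
have c1 : 1 < (2 + b) / 2 + 2 * l%:R by lra.
have icf := inner_smooth_continuous hf.
have if2 := inner_continuous_sqr icf.
have hg := inner_smooth_iter l hf.
have key : ((a ^+ 2 * P)%:E * integral_dV (fun x => (f x ^+ 2 / rho x `^ (b + 2 * (2 * l%:R + 1)))%R)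
   + (2 * (a ^+ 2 * P) * th)%:E *
     integral_dx (fun x => (f x ^+ 2 / rho x `^ (b + 4 * l%:R))%R)
   <= integral_dV (fun x =>
        (hyp_grad_norm (iter l laplace_beltrami f) x ^+ 2 / rho x `^ b)%R))%E.
  have := split_coth_excess icf (ltW a2P) th0 c1.
  rewrite (_ : 2 * ((2 + b) / 2 + 2 * l%:R) = b + 2 * (2 * l%:R + 1)); last by field.
  rewrite (_ : b + 2 * (2 * l%:R + 1) - 2 = b + 4 * l%:R); last by ring.
  move=> h; apply: le_trans h _.
  have H0 x : sqn x < 1 -> 0 <= a ^+ 2 * P * ((1 + th * coth_excess x) * f x ^+ 2).
    move=> x1; have := le_trans (sqn_ge0 x) (coth_excess_ge x1) => Hx.
    by apply: mulr_ge0; [exact: ltW|apply: mulr_ge0; [rewrite addr_ge0// mulr_ge0|exact: sqr_ge0]].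
  have b1 : - b / 2 < 1 by lra.
  have := @regularised_limit R n n3 (- b / 2) ((2 + b) / 2 + 2 * l%:R) _ _ b1 (lt_trans ltr01 c1)
    (inner_continuousZ (a ^+ 2 * P) (inner_continuous_coth th if2))
    (inner_continuous_sqr_hyp_grad hg) H0 (fun x _ => sqr_ge0 _).
  rewrite (_ : 2 * ((2 + b) / 2 + 2 * l%:R) = b + 2 * (2 * l%:R + 1)); last by field.
  rewrite (_ : - (2 * (- b / 2)) = b); last by field.
  apply => d d0.
  have bN : -2 < b < N - 2 by apply/andP; split; lra.
  apply: le_trans (hardy_regularised n3 d0 hg bN erefl).
  rewrite integral_dV_scale; last first.
    by apply: inner_continuous_upow => //; exact/inner_continuous_sqr/inner_smooth_continuous.
  have := iterated_rellich_regularised n3 d0 hf l0 b2' bl'.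
  have a2 : (0 <= (a ^+ 2)%:E)%E by rewrite lee_fin sqr_ge0.
  move=> /(lee_wpmul2l a2).
  rewrite (_ : - (2 + b) / 2 = - b / 2 - 1); last by field.
  apply: le_trans; rewrite -integral_dV_scale; last first.
    apply: inner_continuousZ; apply: inner_continuous_upow => //.
    exact: inner_continuous_coth.
  rewrite le_eqVlt; apply/orP; left; apply/eqP.
  congr integral_dV; apply/funext => x.
  rewrite (_ : - b / 2 - 1 - 2 * l%:R = - ((2 + b) / 2 + 2 * l%:R)); last by field.
  by rewrite -!mulrA.
have cE : 4 / (N - 2 - b) ^+ 2 * rellich_const n l (2 + b) 2 = (a ^+ 2 * P)^-1.
  have -> : rellich_const n l (2 + b) 2 = P^-1 by rewrite /P -rellich_const_inv div1r invrK.
  have an : N - 2 - b != 0 by apply: lt0r_neq0; lra.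
  by rewrite [in RHS]invfM /a; congr (_ * _); field.
rewrite cE.
have c0 : (0 <= ((a ^+ 2 * P)^-1)%:E)%E by rewrite lee_fin invr_ge0 ltW.
apply: le_trans (lee_wpmul2l c0 key).
have aPn := lt0r_neq0 a2P.
have thE : (a ^+ 2 * P)^-1 * (2 * (a ^+ 2 * P) * th) =
    4 * (N - 1) / (N - 2 * (2 * l%:R + 1) - b).
  rewrite /th (_ : N - 4 * l%:R - (2 + b) = N - 2 * (2 * l%:R + 1) - b); last by ring.
  have dn : N - 2 * (2 * l%:R + 1) - b != 0 by apply: lt0r_neq0; lra.
  by move: aPn; move: (a ^+ 2 * P) => z zn; field; rewrite dn zn.
have I1_ge0 : (0 <= integral_dV (fun x =>
    (f x ^+ 2 / rho x `^ (b + 2 * (2 * l%:R + 1)))%R))%E.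
  apply: integral_ge0 => t /poincare_ballE t1.
  by rewrite lee_fin mulr_ge0 ?volume_density_ge0// divr_ge0 ?sqr_ge0 ?powR_ge0.
have I2_ge0 : (0 <= integral_dx (fun x => (f x ^+ 2 / rho x `^ (b + 4 * l%:R))%R))%E.
  by apply: integral_ge0 => t _; rewrite lee_fin divr_ge0 ?sqr_ge0 ?powR_ge0.
move: I1_ge0 I2_ge0; move: (integral_dV _) (integral_dx _) => I1 I2 I1_ge0 I2_ge0.
(* The integrals are not known to be finite here, so distributing the factor over their sum relies
   on nonnegativity. *)
rewrite ge0_muleDr; first last.
- by apply: mule_ge0 => //; rewrite lee_fin mulr_ge0// mulr_ge0// ltW.
- by apply: mule_ge0 => //; rewrite lee_fin ltW.
by rewrite !muleA -!EFinM mulVf// mul1e thE.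
Qed.

End conclusion.

Unset Implicit Arguments.

Theorem theorem5p4 (R : realType) (n k : nat) (beta : R)
    (hn : (3 <= n)%N)
    (hk1 : (1 < k)%N) (hkn : k%:R < n%:R / 2 :> R)
    (hbeta : -2 < beta < n%:R - 2 * k%:R) :
  exists C : R, 0 < C /\
    forall f : 'rV[R]_n -> R, test_function f ->
      (forall l : nat, (1 <= l)%N -> k = (2 * l)%N ->
        (integral_dV (fun x =>
             (`|iter l laplace_beltrami f x| ^+ 2 / powR (rho x) beta)%R)
         >= (1 / rellich_const n l beta 2)%:E *
              integral_dV (fun x =>
                (`|f x| ^+ 2 / powR (rho x) (beta + 4 * l%:R))%R)
            + (6 * C * (n%:R - 1) /
                 ((n%:R - 4 * l%:R - beta) * rellich_const n l beta 2))%:E *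
              integral_dx (fun x =>
                (`|f x| ^+ 2 / powR (rho x) (4 * l%:R + beta - 2))%R))%E)
      /\
      (forall l : nat, (1 <= l)%N -> k = (2 * l + 1)%N ->
        ((4 / (n%:R - 2 - beta) ^+ 2 * rellich_const n l (2 + beta) 2)%:E *
            integral_dV (fun x =>
              (hyp_grad_norm (iter l laplace_beltrami f) x ^+ 2
                / powR (rho x) beta)%R)
         >= integral_dV (fun x =>
                (`|f x| ^+ 2 / powR (rho x) (beta + 2 * (2 * l%:R + 1)))%R)
            + (6 * C * (n%:R - 1) /
                 (n%:R - 2 * (2 * l%:R + 1) - beta))%:E *
              integral_dx (fun x =>
                (`|f x| ^+ 2 / powR (rho x) (beta + 4 * l%:R))%R))%E).
Proof.
have /andP[b2 bk] := hbeta.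
have normE (g h : 'rV[R]_n -> R) :
    (fun x => `|g x| ^+ 2 / h x) = (fun x => g x ^+ 2 / h x).
  by apply/funext => x; rewrite real_normK ?num_real.
(* Chosen so that [6C = 4]: a factor 2 from the Rellich remainder and a factor 2 from the volume
   comparison. *)
exists (2 / 3); split=> [|f /test_function_inner_smooth hf].
  by rewrite divr_gt0.
have C6 : 6 * (2 / 3) = 4 :> R by field.
rewrite C6; split=> l l1 kE; rewrite !normE.
- apply: rellich_even => //.
  by move: bk; rewrite kE natrM; lra.
- apply: rellich_odd => //.
  by move: bk; rewrite kE natrD natrM; lra.
Qed.
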